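(* Let $d,q$ be positive integers and $n=dq$. The map from $G(d,1,q)$ to the set of partitions of the (vertex set of the) regular $n$-gon that sends every element of $G(d,1,q)$ to the partition given by the orbits of its image in $\mathfrak{S}_n$ induces a poset isomorphism from $I_{c(d,1,q)}(G(d,1,q))$ to $\mathrm{NCP}(d,1,q):=\mathrm{NCP}(1,1,n)^{\mu_d}$, where $\mathrm{NCP}(1,1,n)$ denotes the set of noncrossing partitions of the regular $n$-gon.
   Context: $\zeta_m=\exp(2i\pi/m)$; $\mu_m$ is the group of $m$-th roots of unity. $G(d,1,q)$ is the group of $q\times q$ monomial matrices with nonzero entries in $\mu_d$, acting on $\mathbb{C}^q$ with basis $e_1,\dots,e_q$. $c(d,1,q)\in G(d,1,q)$ is the matrix with $e_i\mapsto e_{i+1}$ for $1\le i<q$ and $e_q\mapsto\zeta_d e_1$. With $R$ the set of reflections of $G(d,1,q)$ acting on $\mathbb{C}^q$ and $\ell_R$ the corresponding word length, $v\preceq w$ means $\ell_R(v)+\ell_R(v^{-1}w)=\ell_R(w)$, and $I_{c(d,1,q)}(G(d,1,q))=\{w: w\preceq c(d,1,q)\}$, ordered by $\preceq$. Embedding in $\mathfrak{S}_n$: label $n$ points as $e(j,i)$ with $j\in\mathbb{Z}/d$, $1\le i\le q$ (thinking of $e(j,i)$ as $\zeta_d^je_i$). An element $w\in G(d,1,q)$ with $w e_i=\zeta_d^{a}e_k$ acts by $e(j,i)\mapsto e(j+a,k)$. This identifies $G(d,1,q)$ with the centralizer in $\mathfrak{S}_n$ of $c(1,1,n)^q$, where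 $c(1,1,n)$ is the $n$-cycle $(e(0,1)\,e(0,2)\cdots e(0,q)\,e(1,1)\cdots e(d-1,q))$, and maps $c(d,1,q)$ to $c(1,1,n)$. The points $e(0,1),\dots,e(0,q),e(1,1),\dots,e(d-1,q)$ are the consecutive vertices of the regular $n$-gon (identified with $\mu_n$). A partition is noncrossing if the convex hulls of its distinct parts are pairwise disjoint; noncrossing partitions are ordered by refinement (finer partitions being smaller). $\mu_d$ acts on $\mathrm{NCP}(1,1,n)$ through rotations of the $n$-gon, and the superscript denotes the invariant partitions, with the induced order. *)

(* Defs.v *)
From HB Require Import structures.
From mathcomp Require Import all_boot all_order all_algebra all_fingroup.
From mathcomp Require Import all_classical all_reals all_analysis.
From mathcomp Require Export complex.

Set Implicit Arguments.
Unset Strict Implicit.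
Unset Printing Implicit Defensive.

Import Order.TTheory GRing.Theory Num.Theory.
Local Open Scope classical_set_scope.
Local Open Scope ring_scope.
Local Open Scope complex_scope.

Definition zeta (R : realType) (m : nat) : R[i] :=
  Complex (cos (2 * pi / m%:R)) (sin (2 * pi / m%:R)).

(* Matrices act on column vectors: w e_i is column i of w. *)
Definition Gd1q (R : realType) (d q : nat) : set 'M[R[i]]_q :=
  [set w | [/\ forall i, exists! k, w k i != 0,
               forall k, exists! i, w k i != 0 &
               forall k i, w k i != 0 -> d.-unity_root (w k i)]].
Arguments Gd1q R d q : clear implicits.

Definition coxeter (R : realType) (d q : nat) : 'M[R[i]]_q :=
  \matrix_(k, i) if k == i.+1 :> nat then 1
                 else if (i.+1 == q) && (k == 0 :> nat) then zeta R d else 0.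
Arguments coxeter R d q : clear implicits.

(* [eigenspace] acts on row vectors, whence the transpose: the space of
   vectors fixed by w is a hyperplane. *)
Definition reflections (R : realType) (d q : nat) : set 'M[R[i]]_q :=
  [set w | Gd1q R d q w /\ (\rank (eigenspace w^T 1)).+1 = q].
Arguments reflections R d q : clear implicits.

Definition is_word_length (R : realType) (d q : nat) (w : 'M[R[i]]_q)
    (k : nat) : Prop :=
  exists rs : seq 'M[R[i]]_q,
    [/\ size rs = k, forall r, r \in rs -> reflections R d q r &
        \big[mulmx/1%:M]_(r <- rs) r = w].

(* The least length of a word; the default 0 is irrelevant on G(d,1,q), which
   is generated by its reflections. *)
Definition refl_length (R : realType) (d q : nat) (w : 'M[R[i]]_q) : nat :=
  xget 0%N [set k | is_word_length d w k /\
                    forall l, is_word_length d w l -> (k <= l)%N].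

Definition absle (R : realType) (d q : nat) (v w : 'M[R[i]]_q) : Prop :=
  (refl_length d v + refl_length d (invmx v *m w) = refl_length d w)%N.

Definition interval_c (R : realType) (d q : nat) : set 'M[R[i]]_q :=
  [set w | Gd1q R d q w /\ absle d w (coxeter R d q)].
Arguments interval_c R d q : clear implicits.

(* The point e(j,i), as the vertex number j * q + i of the n-gon, n = d * q;
   here i ranges over 0, ..., q - 1. *)
Lemma point_subproof (d q : nat) (j : 'I_d) (i : 'I_q) : (j * q + i < d * q)%N.
Proof.
apply: (@leq_trans (j.+1 * q)); first by rewrite mulSn addnC ltn_add2r.
by rewrite leq_mul2r ltn_ord orbT.
Qed.

Definition point (d q : nat) (j : 'I_d) (i : 'I_q) : 'I_(d * q) :=
  Ordinal (point_subproof j i).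

(* Addition in Z/d, including the case d = 1. *)
Definition addZ (d : nat) (j a : 'I_d) : 'I_d :=
  Ordinal (ltn_pmod (j + a) (leq_ltn_trans (leq0n j) (ltn_ord j))).

(* If w e_i = zeta_d^a e_k, then e(j,i) is sent to e(j + a,k). For w in
   G(d,1,q) there is exactly one such permutation. *)
Definition acts_as (R : realType) (d q : nat) (w : 'M[R[i]]_q)
    (s : 'S_(d * q)) : bool :=
  [forall i : 'I_q, forall k : 'I_q, forall a : 'I_d,
    (col i w == zeta R d ^+ a *: delta_mx k 0) ==>
    [forall j : 'I_d, s (point j i) == point (addZ j a) k]].

Definition perm_image (R : realType) (d q : nat) (w : 'M[R[i]]_q) :
    'S_(d * q) :=
  odflt 1%g [pick s | acts_as w s].

Definition mx_orbits (R : realType) (d q : nat) (w : 'M[R[i]]_q) :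
    {set {set 'I_(d * q)}} :=
  porbits (perm_image d w).
Arguments mx_orbits {R} d {q} w.

Definition vertex (R : realType) (n : nat) (x : 'I_n) : R[i] := zeta R n ^+ x.
Arguments vertex R {n} x.

Definition hull (R : realType) (n : nat) (A : {set 'I_n}) : set R[i] :=
  [set z | exists l : 'I_n -> R,
     [/\ forall x, 0 <= l x, \sum_(x in A) l x = 1 &
         z = \sum_(x in A) (l x)%:C * vertex R x]].
Arguments hull R {n} A _.

Definition NCP11 (R : realType) (n : nat) : set {set {set 'I_n}} :=
  [set P | finset.partition P [set: 'I_n]%SET /\
           forall A B, A \in P -> B \in P -> A != B ->
             hull R A `&` hull R B = set0].
Arguments NCP11 R n : clear implicits.

Definition rotate (R : realType) (n : nat) (z : R[i]) (A : {set 'I_n}) :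
    {set 'I_n} :=
  [set y | [exists x in A, vertex R y == z * vertex R x]]%SET.

Definition NCPd1 (R : realType) (d q : nat) : set {set {set 'I_(d * q)}} :=
  [set P | NCP11 R (d * q) P /\
           forall z : R[i], d.-unity_root z ->
             [set rotate z A | A in P]%SET = P].
Arguments NCPd1 R d q : clear implicits.

Definition refines (n : nat) (P Q : {set {set 'I_n}}) : Prop :=
  forall A, A \in P -> exists2 B, B \in Q & A \subset B.

(* Main.v *)
(* An element w of G(d,1,q) has reflection length codim Fix(w): the rank of
   ab - 1 is subadditive, and as long as w is not 1 some reflection r with
   Fix(w) inside Fix(r) lowers the codimension of the fixed space.  Let s be the
   image of w in S_n.  A fixed vector of w is a function on the orbits of s
   which is multiplied by a root of unity under the rotations; counting
   dimensions gives

     (n - #orbits of s) + #{orbits stable under a nontrivial rotation}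
       = d * (reflection length of w).

   The first term is the length of s in S_n.  Hence the two absolute orders,
   below the Coxeter elements, differ only by the numbers of stable orbits.  A
   noncrossing partition has at most one stable block, since 0 lies in the
   convex hull of such a block; together with the sign of permutations this
   forces the two orders to agree there.

   In S_n, an element below the n-cycle has noncrossing orbits; conversely
   the permutation sending each point to the next point of its block in a
   noncrossing partition is below the n-cycle.  Finally, an element below c is
   determined by its moved space, and inclusion of moved and fixed spaces
   implies the order relation (Brady and Watt); this gives injectivity and the
   comparison of the orders. *)
From mathcomp Require Import all_boot all_order all_algebra all_fingroup.
From mathcomp Require Import zify ring lra.

Set Implicit Arguments.
Unset Strict Implicit.
Unset Printing Implicit Defensive.

Import GRing.Theory.
Local Open Scope ring_scope.

(** * Fixed and moved spaces *)

Section LinearAlgebra.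
Variables (F : fieldType) (m : nat).
Implicit Types A B C : 'M[F]_m.

Definition codim_fix A := \rank (A - 1%:M).

Lemma codim_fix_le A : (codim_fix A <= m)%N.
Proof. exact: rank_leq_row. Qed.

Lemma codim_fixM A B : (codim_fix (A *m B) <= codim_fix A + codim_fix B)%N.
Proof.
rewrite /codim_fix; have -> : A *m B - 1%:M = (A - 1%:M) *m B + (B - 1%:M).
  by rewrite mulmxBl mul1mx addrA subrK.
apply: leq_trans (mxrank_add _ _) _.
by rewrite leq_add2r mxrankM_maxl.
Qed.

Lemma fixP A (x : 'rV[F]_m) : reflect (x *m A = x) (x <= kermx (A - 1%:M))%MS.
Proof.
apply: (iffP sub_kermxP) => [|xA]; last by rewrite mulmxBr mulmx1 xA subrr.
by rewrite mulmxBr mulmx1 => /eqP; rewrite subr_eq0 => /eqP.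
Qed.

Lemma rank_ker_subr A B : \rank (kermx (A - B)) = (m - \rank (A - B)%R)%N.
Proof. exact: mxrank_ker. Qed.

(** The common fixed space of A and B lies in that of AB, and its codimension is at most the sum of
    the two codimensions; under the hypothesis both spaces therefore coincide. *)
Lemma fix_additive A B : (codim_fix A + codim_fix B <= codim_fix (A *m B))%N ->
  (kermx (A *m B - 1%:M) <= kermx (A - 1%:M))%MS.
Proof.
move=> leAB; set K := (kermx (A - 1%:M) :&: kermx (B - 1%:M))%MS.
have sKAB : (K <= kermx (A *m B - 1%:M))%MS.
  apply/rV_subP => x; rewrite sub_capmx => /andP[/fixP xA /fixP xB].
  by apply/fixP; rewrite mulmxA xA.
have : (K == kermx (A *m B - 1%:M))%MS.
  rewrite -(geq_leqif (mxrank_leqif_eq sKAB)).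
  have := mxrank_sum_cap (kermx (A - 1%:M)) (kermx (B - 1%:M)).
  have := rank_leq_row (kermx (A - 1%:M) + kermx (B - 1%:M))%MS.
  rewrite -/K !rank_ker_subr -!/(codim_fix _).
  have := codim_fix_le A; have := codim_fix_le B; move: leAB; lia.
case/andP => _ /submx_trans; apply; exact: capmxSl.
Qed.

(* When V lies below C, a vector has the same image under V and C iff its
   displacement by C lies in the moved space of V. *)
Lemma ker_below V C : (codim_fix V + \rank (V - C)%R <= codim_fix C)%N ->
  (kermx ((C - 1%:M) *m cokermx (V - 1%:M)) <= kermx (V - C))%MS.
Proof.
move=> leVC; set K := kermx (_ *m _).
have sVK : (kermx (V - C) <= K)%MS.
  apply/rV_subP => x /sub_kermxP; rewrite mulmxBr => /eqP.
  rewrite subr_eq0 => /eqP xVC; apply/sub_kermxP; rewrite mulmxA.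
  apply/eqP; rewrite -submxE mulmxBr -xVC -mulmxBr; exact: submxMl.
have : (kermx (V - C) == K)%MS; last by case/andP.
rewrite -(geq_leqif (mxrank_leqif_eq sVK)) rank_ker_subr /K mxrank_ker.
have := mxrank_mul_ker (C - 1%:M) (cokermx (V - 1%:M)).
have : (\rank ((C - 1%:M)%R :&: kermx (cokermx (V - 1%:M))) <= codim_fix V)%N.
  apply/mxrankS/(submx_trans (capmxSr _ _)).
  by rewrite submxE mulmx_ker.
have := codim_fix_le C; have := rank_leq_row (V - C); move: leVC.
rewrite /codim_fix; lia.
Qed.

(* ker (V - W) contains ker (W - 1) and ker (V - C), whose intersection is
   contained in ker (C - 1). *)
Lemma below_of_subspaces V W C :
  (codim_fix V + \rank (V - C)%R = codim_fix C)%N ->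
  (codim_fix W + \rank (W - C)%R = codim_fix C)%N ->
  (V - 1%:M <= W - 1%:M)%MS -> (kermx (W - 1%:M) <= kermx (V - 1%:M))%MS ->
  (codim_fix V + \rank (V - W)%R <= codim_fix W)%N.
Proof.
move=> leVC leWC movVW fixWV.
have kerP X Y (x : 'rV[F]_m) :
    reflect (x *m X = x *m Y) (x <= kermx (X - Y))%MS.
  by apply: (iffP sub_kermxP); rewrite mulmxBr => /eqP;
     rewrite ?subr_eq0 => /eqP // ->; rewrite subrr.
have sVW : (kermx (V - C) <= kermx (W - C))%MS.
  apply: submx_trans (ker_below (eq_leq leWC)); apply/rV_subP => x.
  move/kerP => xVC; apply/sub_kermxP; rewrite mulmxA.
  apply/eqP; rewrite -submxE mulmxBr -xVC -mulmxBr.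
  exact: submx_trans (submxMl _ _) movVW.
have s1 : (kermx (W - 1%:M) + kermx (V - C) <= kermx (V - W))%MS.
  rewrite addsmx_sub; apply/andP; split; apply/rV_subP => x xk; apply/kerP.
    have /fixP -> := xk.
    by have /fixP -> := submx_trans xk fixWV.
  have /kerP -> := xk; by have /kerP -> := submx_trans xk sVW.
have s2 : (kermx (W - 1%:M) :&: kermx (V - C) <= kermx (C - 1%:M))%MS.
  apply/rV_subP => x; rewrite sub_capmx => /andP[/fixP xW].
  move/submx_trans/(_ sVW)/kerP; rewrite xW => xC; exact/fixP.
(* With v, w, c the codimensions, the sum in [s1] has dimension at least (m - w) + (m - (c - v)) -
   (m - c) = m - (w - v). *)
have := mxrank_sum_cap (kermx (W - 1%:M)) (kermx (V - C)).
have := mxrankS s1; have := mxrankS s2; rewrite !rank_ker_subr.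
have := codim_fix_le C; have := codim_fix_le W; have := codim_fix_le V.
have := rank_leq_row (V - C); have := rank_leq_row (V - W).
move: leVC leWC; rewrite /codim_fix.
move: (\rank (V - W)) (\rank (V - C)) (\rank (V - 1%:M)) (\rank (W - 1%:M)).
move: (\rank (W - C)) (\rank (C - 1%:M)) (\rank (_ + _)%MS) (\rank (_ :&: _)%MS).
lia.
Qed.

End LinearAlgebra.

(** * Rotations of the vertices of the n-gon *)

Section Shift.
Variable n : nat.
Implicit Types (p : 'I_n) (k : nat).

Definition shift k p : 'I_n :=
  Ordinal (ltn_pmod (p + k) (leq_ltn_trans (leq0n p) (ltn_ord p))).

Lemma shift_inj k : injective (shift k).
Proof.
move=> p p' /(congr1 val) /= /eqP; rewrite eqn_modDr !modn_small // => /eqP.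
exact: val_inj.
Qed.

Lemma shiftD k l p : shift k (shift l p) = shift (l + k) p.
Proof. by apply: val_inj; rewrite /= modnDml addnA. Qed.

Lemma shiftC k l p : shift k (shift l p) = shift l (shift k p).
Proof. by rewrite !shiftD addnC. Qed.

Lemma shift0 p : shift 0 p = p.
Proof. by apply: val_inj; rewrite /= addn0 modn_small. Qed.

Lemma shift_modn k p : shift (k %% n) p = shift k p.
Proof. by apply: val_inj; rewrite /= modnDmr. Qed.

Lemma shiftM k m p : shift (k * n + m) p = shift m p.
Proof. by rewrite -shift_modn modnMDl shift_modn. Qed.

Lemma shiftn p : shift n p = p.
Proof. by rewrite -shift_modn modnn shift0. Qed.

Definition rot k : 'S_n := perm (@shift_inj k).

Lemma rotE k p : rot k p = shift k p.
Proof. exact: permE. Qed.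

Lemma rotX k m p : (rot k ^+ m)%g p = shift (m * k) p.
Proof.
elim: m => [|m IHm]; first by rewrite expg0 perm1 shift0.
by rewrite expgSr permM IHm rotE shiftD mulSn addnC.
Qed.

Lemma rotC k l : commute (rot k) (rot l).
Proof. by apply/permP => p; rewrite !permM !rotE shiftC. Qed.

Lemma shift_to p p' : p' = shift (n - p + p') p.
Proof.
apply: val_inj => /=; rewrite addnA subnKC ?(ltnW (ltn_ord p)) //.
by rewrite modnDl modn_small.
Qed.

Lemma porbit_rot1 p : porbit (rot 1) p = [set: 'I_n].
Proof.
apply/setP => p'; rewrite inE; apply/porbitP; exists (n - p + p')%N.
by rewrite rotX muln1 -shift_to.
Qed.

Lemma porbits_rot1 : (0 < n)%N -> porbits (rot 1) = [set [set: 'I_n]].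
Proof.
move=> n_gt0; apply/setP => A; rewrite inE; apply/imsetP/eqP => [[p _ ->]|->].
  exact: porbit_rot1.
by exists (Ordinal n_gt0); rewrite ?porbit_rot1.
Qed.

End Shift.

(** * Monomial matrices *)

Section Monomial.
Variables (F : fieldType) (n d q : nat) (z : F).
Hypotheses (q_gt0 : (0 < q)%N) (hn : n = (d * q)%N).
Hypothesis z_prim : d.-primitive_root z.
Implicit Types (s t : 'S_n) (p : 'I_n).

Notation cen := 'C[rot n q]%g.

Let d_gt0 : (0 < d)%N. Proof. exact: prim_order_gt0 z_prim. Qed.

Let z_neq0 : z != 0.
Proof.
apply/eqP => z0; have := prim_expr_order z_prim.
by rewrite z0 expr0n eqn0Ngt d_gt0 => /eqP; rewrite eq_sym oner_eq0.
Qed.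

Lemma cen_shift s a p : s \in cen -> s (shift (a * q) p) = shift (a * q) (s p).
Proof.
move=> /cent1P sC; rewrite -!rotX -!permM.
by rewrite (commuteX a sC).
Qed.

Lemma cenP s : (forall p, s (shift q p) = shift q (s p)) -> s \in cen.
Proof. by move=> sC; apply/cent1P/permP => p; rewrite !permM !rotE sC. Qed.

Lemma modq_shift p p' : p = p' %[mod q] -> exists a, p' = shift (a * q) p.
Proof.
(* The summand [d] keeps the subtraction from truncating; it costs a full turn d * q = n, which
   vanishes modulo n. *)
move=> pp'; exists (d - p %/ q + p' %/ q)%N; apply: val_inj => /=.
have lt_pd : (p %/ q < d)%N by rewrite ltn_divLR // -hn.
rewrite mulnDl mulnBl {1}(divn_eq p q) [in LHS](divn_eq p' q) -pp'.
have -> : (p %/ q * q + p %% q + (d * q - p %/ q * q + p' %/ q * q) =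
           d * q + (p' %/ q * q + p %% q))%N.
  have : (p %/ q * q <= d * q)%N by rewrite leq_mul2r (ltnW lt_pd) orbT.
  lia.
by rewrite -hn modnDl pp' -divn_eq modn_small.
Qed.

Lemma modn_modq k : k %% n = k %[mod q].
Proof. by rewrite hn modn_dvdm ?dvdn_mull. Qed.

Lemma shift_modq a p : shift (a * q) p = p %[mod q].
Proof. by rewrite modn_modq addnC modnMDl. Qed.

Lemma shiftq_inj a b p :
  (a < d)%N -> (b < d)%N -> shift (a * q) p = shift (b * q) p -> a = b.
Proof.
move=> ad bd /(congr1 val) /= /eqP; rewrite eqn_modDl hn.
by rewrite -!muln_modl !modn_small // eqn_pmul2r // => /eqP.
Qed.

(* The point p = e(j,i) is the number j * q + i, and vec p stands for the vector
   z^j e_i.  The family dvec is dual to vec: x |-> (p |-> x *m dvec p) identifies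
   row vectors with the functions of p that are multiplied by z^-1 under the
   rotation p |-> p + q. *)
Definition vec (k : nat) : 'rV[F]_q :=
  z ^+ (k %/ q) *: delta_mx 0 (Ordinal (ltn_pmod k q_gt0)).
Definition dvec (k : nat) : 'cV[F]_q :=
  z ^- (k %/ q) *: delta_mx (Ordinal (ltn_pmod k q_gt0)) 0.

Lemma modq_ord k l : k = l %[mod q] ->
  Ordinal (ltn_pmod k q_gt0) = Ordinal (ltn_pmod l q_gt0).
Proof. by move=> e; apply: val_inj. Qed.

Lemma z_mod k : z ^+ ((k %% n) %/ q) = z ^+ (k %/ q).
Proof. by rewrite hn -modn_divl (prim_expr_mod z_prim). Qed.

Lemma vec_mod k : vec (k %% n) = vec k.
Proof.
rewrite /vec z_mod; congr (_ *: delta_mx _ _); apply: modq_ord.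
exact: modn_modq.
Qed.

Lemma dvec_mod k : dvec (k %% n) = dvec k.
Proof.
rewrite /dvec z_mod; congr (_ *: delta_mx _ _); apply: modq_ord.
exact: modn_modq.
Qed.

Lemma vec_shift a p : vec (shift (a * q) p) = z ^+ a *: vec p.
Proof.
rewrite vec_mod /vec addnC divnMDl // exprD scalerA.
by congr (_ *: delta_mx _ _); apply: modq_ord; rewrite modnMDl.
Qed.

Lemma dvec_shift a p : dvec (shift (a * q) p) = z ^- a *: dvec p.
Proof.
rewrite dvec_mod /dvec addnC divnMDl // exprD scalerA invfM.
by congr (_ *: delta_mx _ _); apply: modq_ord; rewrite modnMDl.
Qed.

Lemma vec_dvec p : vec p *m dvec p = 1%:M.
Proof.
rewrite /vec /dvec -scalemxAl -scalemxAr mul_delta_mx scalerA.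
rewrite divff ?expf_neq0 // scale1r.
by apply/matrixP => i j; rewrite !mxE !ord1.
Qed.

Lemma vec_dvec0 k l : k <> l %[mod q] -> vec k *m dvec l = 0.
Proof.
move=> kl; rewrite /vec /dvec -scalemxAl -scalemxAr mul_delta_mx_0 ?scaler0 //.
by apply/eqP => /(congr1 val).
Qed.

Lemma vec_dvec_shift a p : vec (shift (a * q) p) *m dvec p = (z ^+ a)%:M.
Proof. by rewrite vec_shift -scalemxAl vec_dvec scalemx1. Qed.

Lemma cen_modq s p p' : s \in cen -> (s p == s p' %[mod q]) = (p == p' %[mod q]).
Proof.
move=> sC; apply/eqP/eqP => /modq_shift[a].
  by rewrite -cen_shift // => /perm_inj ->; rewrite shift_modq.
by move->; rewrite cen_shift // shift_modq.
Qed.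

Lemma vec_dvec_perm s p p' : s \in cen ->
  vec (s p') *m dvec (s p) = vec p' *m dvec p.
Proof.
move=> sC; have := cen_modq p p' sC.
case: ((p %% q)%N =P (p' %% q)%N) => [/modq_shift[a ->] _|pp' /eqP spp'].
  by rewrite cen_shift // !vec_dvec_shift.
by rewrite !vec_dvec0 // => e; [case: pp' | case: spp'].
Qed.

Lemma low_subproof (i : 'I_q) : (i < n)%N.
Proof. by rewrite hn (leq_trans (ltn_ord i)) // leq_pmull. Qed.
Definition low i : 'I_n := Ordinal (low_subproof i).

Lemma vec_low i : vec (low i) = delta_mx 0 i.
Proof.
rewrite /vec divn_small ?(ltn_ord i) // expr0 scale1r; congr (delta_mx _ _).
by apply: val_inj; rewrite /= modn_small.
Qed.

Lemma dvec_low i : dvec (low i) = delta_mx i 0.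
Proof.
rewrite /dvec divn_small ?(ltn_ord i) // expr0 invr1 scale1r; congr (delta_mx _ _).
by apply: val_inj; rewrite /= modn_small.
Qed.

Lemma shift_low p : exists a i, p = shift (a * q) (low i).
Proof.
have [a pE] := @modq_shift (low (Ordinal (ltn_pmod p q_gt0))) p (modn_mod _ _).
by exists a, (Ordinal (ltn_pmod p q_gt0)).
Qed.

Lemma vec_ext m (A B : 'M[F]_(q, m)) :
  (forall p, vec p *m A = vec p *m B) -> A = B.
Proof.
by move=> AB; apply/row_matrixP => i; rewrite !rowE -vec_low AB.
Qed.

Lemma dvec_ext m (A B : 'M[F]_(m, q)) :
  (forall p, A *m dvec p = B *m dvec p) -> A = B.
Proof.
move=> AB; apply: trmx_inj; apply/row_matrixP => i.
by rewrite -!tr_col !colE -dvec_low AB.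
Qed.

Lemma vec_inj p p' : vec p = vec p' -> p = p'.
Proof.
move=> e; case: ((p %% q)%N =P (p' %% q)%N) => [/modq_shift[a p'E]|pp']; last first.
  have := vec_dvec p'; rewrite -e vec_dvec0 // => /matrixP/(_ 0 0).
  by rewrite !mxE => /esym/eqP; rewrite oner_eq0.
have za : z ^+ a = 1.
  have := vec_dvec_shift a p; rewrite -p'E -e vec_dvec => /matrixP/(_ 0 0).
  by rewrite !mxE.
have /dvdnP[b ab] : (d %| a)%N by rewrite (prim_order_dvd z_prim) za.
by rewrite p'E ab -mulnA -hn -[(_ * _)%N]addn0 shiftM shift0.
Qed.

(** Rows are the images of the basis vectors, so that [Mx] turns the left-to-right product of
    permutations into the product of matrices. *)
Definition Mx s : 'M[F]_q := \matrix_i vec (s (low i)).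

Lemma vecM s p : s \in cen -> vec p *m Mx s = vec (s p).
Proof.
move=> sC; have [a [i ->]] := shift_low p.
by rewrite cen_shift // !vec_shift -scalemxAl vec_low -rowE rowK.
Qed.

Lemma dvecM s p : s \in cen -> Mx s *m dvec (s p) = dvec p.
Proof.
move=> sC; apply: vec_ext => p'.
by rewrite mulmxA vecM // vec_dvec_perm.
Qed.

Lemma MxM s t : s \in cen -> t \in cen -> Mx (s * t)%g = Mx s *m Mx t.
Proof.
move=> sC tC; apply: vec_ext => p.
by rewrite mulmxA !vecM ?groupM // permM.
Qed.

Lemma Mx1 : Mx 1%g = 1%:M.
Proof. by apply: vec_ext => p; rewrite vecM ?group1 // perm1 mulmx1. Qed.

Lemma Mx_inj : {in cen &, injective Mx}.
Proof.
move=> s t sC tC st; apply/permP => p; apply: vec_inj.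
by rewrite -!vecM // st.
Qed.

Lemma MxVl s : s \in cen -> Mx s^-1%g *m Mx s = 1%:M.
Proof. by move=> sC; rewrite -MxM ?groupV // mulVg Mx1. Qed.

Lemma MxVr s : s \in cen -> Mx s *m Mx s^-1%g = 1%:M.
Proof. by move=> sC; rewrite -MxM ?groupV // mulgV Mx1. Qed.

Lemma MxV s : s \in cen -> Mx s^-1%g = invmx (Mx s).
Proof.
move=> sC; have [u _] := mulmx1_unit (MxVr sC).
by rewrite -[LHS]mul1mx -(mulVmx u) -mulmxA MxVr // mulmx1.
Qed.

Lemma fix_dvecP s (x : 'rV[F]_q) : s \in cen ->
  reflect (forall p, x *m dvec (s p) = x *m dvec p)
          (x <= kermx (Mx s - 1%:M))%MS.
Proof.
move=> sC; apply: (iffP (fixP _ _)) => [xs p|xs].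
  by rewrite -{1}xs -mulmxA dvecM.
by apply: dvec_ext => p; rewrite -(permKV s p) -mulmxA dvecM.
Qed.

Definition refl_len s := codim_fix (Mx s).

Definition below s t := (refl_len s + refl_len (s^-1 * t)%g)%N = refl_len t.

Lemma refl_lenM s t : s \in cen -> t \in cen ->
  (refl_len (s * t)%g <= refl_len s + refl_len t)%N.
Proof. by move=> sC tC; rewrite /refl_len MxM ?codim_fixM. Qed.

Lemma refl_len_quot s t : s \in cen -> t \in cen ->
  (refl_len t <= refl_len s + refl_len (s^-1 * t)%g)%N.
Proof. by move=> sC tC; rewrite -{1}(mulKVg s t) refl_lenM ?groupM ?groupV. Qed.

Lemma refl_len_quotE s t : s \in cen -> t \in cen ->
  refl_len (s^-1 * t)%g = \rank (Mx s - Mx t).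
Proof.
move=> sC tC; rewrite /refl_len /codim_fix MxM ?groupV //.
have -> : Mx s - Mx t = Mx s *m (- (Mx s^-1%g *m Mx t - 1%:M)).
  by rewrite mulmxN mulmxBr mulmxA MxVr // mul1mx mulmx1 opprB.
have [u _] := mulmx1_unit (MxVr sC).
by rewrite (eqmxMfull _ _) ?eqmx_opp // row_full_unit.
Qed.

Lemma refl_lenJ s t : s \in cen -> t \in cen ->
  refl_len (s ^ t)%g = refl_len s.
Proof.
have leJ u v : u \in cen -> v \in cen -> (refl_len (u ^ v)%g <= refl_len u)%N.
  move=> uC vC; rewrite /refl_len /codim_fix conjgE !MxM ?groupM ?groupV //.
  rewrite -[X in (\rank (_ - X)%R <= _)%N](MxVl vC) -[X in _ *m _ - _ *m X](mul1mx (Mx v)).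
  rewrite -mulmxBr -mulmxBl; apply: leq_trans (mxrankM_maxr _ _) _.
  exact: mxrankM_maxl.
move=> sC tC; apply/eqP; rewrite eqn_leq leJ //=.
by rewrite -{1}(conjgK t s) leJ ?groupV // groupJ.
Qed.

Lemma refl_lenV_quot s t : s \in cen -> t \in cen ->
  refl_len (t * s^-1)%g = refl_len (s^-1 * t)%g.
Proof.
move=> sC tC; rewrite -(@refl_lenJ (t * s^-1)%g s) ?groupM ?groupV //.
by rewrite conjgE !mulgA mulgKV.
Qed.

Lemma below_compl s t : s \in cen -> t \in cen -> below s t ->
  below (s^-1 * t)%g t.
Proof.
move=> sC tC st; rewrite /below invMg invgK -mulgA -conjgE.
by rewrite refl_lenJ // addnC.
Qed.

Lemma below_fix s t : s \in cen -> t \in cen -> below s t ->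
  (kermx (Mx t - 1%:M) <= kermx (Mx s - 1%:M))%MS.
Proof.
move=> sC tC st; rewrite -{1}(mulKVg s t) MxM ?groupM ?groupV //.
apply: fix_additive; rewrite -MxM ?groupM ?groupV // mulKVg.
by rewrite -!/(refl_len _) st.
Qed.

Definition refines_orbits s t := forall p, s p \in porbit t p.

Lemma vec_porbit t p p' : t \in cen -> p' \in porbit t p ->
  (vec p' - vec p <= Mx t - 1%:M)%MS.
Proof.
move=> tC /porbitP[k ->]; elim: k => [|k IHk].
  by rewrite expg0 perm1 subrr sub0mx.
rewrite expgSr permM; set p1 := _ p in IHk *.
rewrite -(subrK (vec p1) (vec (t p1))) -addrA addmx_sub //.
by rewrite -vecM // -{2}(mulmx1 (vec p1)) -mulmxBr submxMl.
Qed.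

Lemma fix_porbit t p p' (x : 'rV[F]_q) : t \in cen -> p' \in porbit t p ->
  (x <= kermx (Mx t - 1%:M))%MS -> x *m dvec p' = x *m dvec p.
Proof.
move=> tC /porbitP[k ->] /(fix_dvecP _ tC) xt; elim: k => [|k IHk].
  by rewrite expg0 perm1.
by rewrite expgSr permM xt.
Qed.

Lemma refines_fix s t : s \in cen -> t \in cen -> refines_orbits s t ->
  (kermx (Mx t - 1%:M) <= kermx (Mx s - 1%:M))%MS.
Proof.
move=> sC tC st; apply/rV_subP => x xt; apply/fix_dvecP => // p.
exact: fix_porbit (st p) xt.
Qed.

Lemma refines_moved s t : s \in cen -> t \in cen -> refines_orbits s t ->
  (Mx s - 1%:M <= Mx t - 1%:M)%MS.
Proof.
move=> sC tC st; apply/row_subP => i.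
rewrite rowE mulmxBr mulmx1 -vec_low vecM //; exact: vec_porbit.
Qed.

(** Refinement gives the inclusions of fixed and moved spaces, hence one inequality by
    [below_of_subspaces]; the other is subadditivity. *)
Lemma refines_below s t c : s \in cen -> t \in cen -> c \in cen ->
  below s c -> below t c -> refines_orbits s t -> below s t.
Proof.
move=> sC tC cC; rewrite /below !refl_len_quotE // => sc tc st.
apply/eqP; rewrite eqn_leq; apply/andP; split; last first.
  by rewrite -refl_len_quotE // refl_len_quot.
exact: below_of_subspaces sc tc (refines_moved sC tC st) (refines_fix sC tC st).
Qed.

Lemma refl_len0 s : s \in cen -> refl_len s = 0%N -> s = 1%g.
Proof.
move=> sC /eqP; rewrite mxrank_eq0 subr_eq0 => /eqP e.
by apply: Mx_inj; rewrite ?group1 // Mx1.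
Qed.

Lemma below_antisym s t : s \in cen -> t \in cen ->
  below s t -> below t s -> s = t.
Proof.
move=> sC tC; rewrite /below => st ts.
have /refl_len0 : refl_len (s^-1 * t)%g = 0%N by lia.
rewrite groupM ?groupV // => /(_ isT) /(canRL (mulKVg s)).
by rewrite mulg1.
Qed.


(** * Orbits stable under rotations and the dimension of the fixed space *)

Definition turn a (A : {set 'I_n}) := [set shift (a * q) p | p in A].

Definition stable (A : {set 'I_n}) :=
  [exists a : 'I_d, (0 < a)%N && (turn a A == A)].

Lemma mem_turn a p (A : {set _}) : p \in A -> shift (a * q) p \in turn a A.
Proof. exact: imset_f. Qed.

Lemma turn_inj a : injective (turn a).
Proof. exact/imset_inj/shift_inj. Qed.

Lemma turnD a b A : turn a (turn b A) = turn (a + b) A.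
Proof.
rewrite /turn -imset_comp; apply: eq_imset => p /=.
by rewrite shiftD -mulnDl addnC.
Qed.

Lemma turn_mod a A : turn (a %% d) A = turn a A.
Proof.
by apply: eq_imset => p; rewrite muln_modl -hn shift_modn.
Qed.

Lemma turn0 A : turn 0 A = A.
Proof.
rewrite /turn -[RHS]imset_id; apply: eq_imset => p.
by rewrite mul0n shift0.
Qed.

Lemma stable_turn a A : stable (turn a A) = stable A.
Proof.
apply: eq_existsb => b; rewrite turnD addnC -turnD.
by rewrite (inj_eq (@turn_inj a)).
Qed.

Lemma stableP a A : ~~ stable A -> turn a A = A -> (d %| a)%N.
Proof.
rewrite /stable negb_exists => /forallP/(_ (Ordinal (ltn_pmod a d_gt0))) /=.
by rewrite turn_mod negb_and -leqNgt leqn0 => /orP[//|/eqP].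
Qed.

Lemma turn_porbit s a p : s \in cen ->
  turn a (porbit s p) = porbit s (shift (a * q) p).
Proof.
move=> sC; apply/setP => y; apply/imsetP/porbitP => [[_ /porbitP[k ->] ->]|[k ->]].
  by exists k; rewrite cen_shift // groupX.
by exists ((s ^+ k)%g p); rewrite ?mem_porbit // cen_shift // groupX.
Qed.

Lemma eq_porbit s p p' : p' \in porbit s p -> porbit s p' = porbit s p.
Proof. by rewrite -eq_porbit_mem => /eqP. Qed.

(** A fixed vector takes equal values at p and at some p + a q of the same orbit with 0 < a < d, but
    these values differ by the factor z^-a, which is not 1. *)
Lemma fix_stable0 s p (x : 'rV[F]_q) : s \in cen -> stable (porbit s p) ->
  (x <= kermx (Mx s - 1%:M))%MS -> x *m dvec p = 0.
Proof.
move=> sC /existsP[a /andP[a_gt0 /eqP sa]] xs.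
have : shift (a * q) p \in porbit s p by rewrite -sa mem_turn ?porbit_id.
move=> /(fix_porbit sC)/(_ xs); rewrite dvec_shift -scalemxAr => /eqP.
rewrite -subr_eq0 -{2}[_ *m _]scale1r -scalerBl scaler_eq0 subr_eq0.
case/orP => /eqP // /eqP; rewrite invr_eq1 -(prim_order_dvd z_prim).
by rewrite gtnNdvd // => /eqP.
Qed.

Definition orbit_sum (A : {set 'I_n}) : 'rV[F]_q := \sum_(p in A) vec p.

Lemma orbit_sum_fix s p : s \in cen ->
  (orbit_sum (porbit s p) <= kermx (Mx s - 1%:M))%MS.
Proof.
move=> sC; apply/fixP; rewrite mulmx_suml [RHS](reindex_inj (@perm_inj _ s)).
apply: eq_big => [p'|p' _]; last by rewrite vecM.
rewrite ![_ \in porbit s p]porbit_sym.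
by have := porbit_perm s 1 p'; rewrite expg1 => ->.
Qed.

(** In an orbit that is not stable no two distinct points are congruent modulo q, so a single term
    of the sum survives. *)
Lemma orbit_sum_dvec s p p' : s \in cen -> ~~ stable (porbit s p) ->
  p' \in porbit s p -> orbit_sum (porbit s p) *m dvec p' = 1%:M.
Proof.
move=> sC nst pp'; rewrite mulmx_suml (bigD1 p') //= vec_dvec.
rewrite big1 ?addr0 // => p2 /andP[p2p p2p'].
apply: vec_dvec0 => /esym/modq_shift[a p2E].
have /dvdnP[b ab] : (d %| a)%N.
  apply: (stableP nst); rewrite -(eq_porbit pp') turn_porbit // -p2E.
  by rewrite (eq_porbit p2p) (eq_porbit pp').
by case/eqP: p2p'; rewrite p2E ab -mulnA -hn -[(_ * _)%N]addn0 shiftM shift0.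
Qed.

Lemma orbit_sum_dvec0 A p : (forall a, p \notin turn a A) ->
  orbit_sum A *m dvec p = 0.
Proof.
move=> pA; rewrite mulmx_suml big1 // => p' p'A.
apply: vec_dvec0 => /modq_shift[a pE].
by case/negP: (pA a); rewrite pE mem_turn.
Qed.

(* A fixed vector, seen as a function on the orbits, vanishes on the stable ones
   and is determined by its values on representatives of the other ones modulo
   rotation. *)
Lemma rank_fix s (Tr : {set {set 'I_n}}) : s \in cen ->
  (forall B, B \in Tr -> B \in porbits s /\ ~~ stable B) ->
  (forall p, ~~ stable (porbit s p) -> exists a, turn a (porbit s p) \in Tr) ->
  (forall a B, B \in Tr -> turn a B \in Tr -> turn a B = B) ->
  \rank (kermx (Mx s - 1%:M)) = #|Tr|.
Proof.
move=> sC TrP TrE TrU.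
pose O (i : 'I_#|Tr|) : {set 'I_n} := enum_val i.
have mem i : O i \in Tr := enum_valP i.
have blk i p : p \in O i -> O i = porbit s p.
  have [/imsetP[p0 _ ->] _] := TrP _ (mem i).
  by move=> /eq_porbit.
have [f fP] : exists f : 'I_#|Tr| -> 'I_n, forall i, f i \in O i.
  apply: (@fin_all_exists _ (fun=> 'I_n) (fun i p => p \in O i)) => i;
  have [/imsetP[p0 _ ->] _] := TrP _ (mem i).
  by exists p0; exact: porbit_id.
(* The sums over the chosen orbits are shown to be a basis of the fixed space: independent by
   [Mdvec], spanning by comparing values at all points. *)
pose M := \matrix_(i < #|Tr|) orbit_sum (O i).
have Mdvec (y : 'rV_#|Tr|) i p : p \in O i ->
    y *m M *m dvec p = (y 0 i)%:M.
  move=> pi; rewrite (mulmx_sum_row y M) mulmx_suml (bigD1 i) //= big1 => [|j ji].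
    have [_ nst] := TrP _ (mem i).
    rewrite addr0 rowK -scalemxAl (blk _ _ pi) orbit_sum_dvec ?porbit_id //.
      by rewrite scalemx1.
    by rewrite -(blk _ _ pi).
  rewrite rowK -scalemxAl orbit_sum_dvec0 ?scaler0 // => a.
  apply: contra ji => pj; apply/eqP/enum_val_inj; rewrite -/(O j) -/(O i).
  suff e : turn a (O j) = O i by rewrite -e TrU ?mem // e mem.
  rewrite (blk _ _ pi); case/imsetP: pj => p' p'j ->.
  by rewrite (blk _ _ p'j) turn_porbit.
have M_free : row_free M.
  apply: inj_row_free => y yM0; apply/rowP => i; rewrite mxE.
  have := Mdvec y i _ (fP i); rewrite yM0 mul0mx => /matrixP/(_ 0 0).
  by rewrite !mxE.
suff -> : \rank (kermx (Mx s - 1%:M)) = \rank M by apply/eqP.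
apply: eqmx_rank; apply/andP; split; last first.
  apply/row_subP => i; rewrite rowK (blk _ _ (fP i)); exact: orbit_sum_fix.
apply/rV_subP => x xs; apply/submxP.
exists (\row_i (x *m dvec (f i)) 0 0); apply: dvec_ext => p.
have [st|nst] := boolP (stable (porbit s p)).
  rewrite (fix_stable0 sC st xs) (mulmx_sum_row _ M) mulmx_suml big1 // => i _.
  rewrite rowK -scalemxAl orbit_sum_dvec0 ?scaler0 // => a.
  apply: contraL st => /imsetP[p' p'i ->]; rewrite -turn_porbit //.
  rewrite stable_turn -(blk _ _ p'i).
  by case: (TrP _ (mem i)).
have [a aTr] := TrE _ nst.
have [i iE] : exists i, turn a (porbit s p) = O i.
  by exists (enum_rank_in aTr (turn a (porbit s p))); rewrite /O enum_rankK_in.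
have pi : shift (a * q) p \in O i by rewrite -iE mem_turn ?porbit_id.
have /(congr1 ( *:%R (z ^+ a))) : x *m dvec (shift (a * q) p) =
    (\row_i (x *m dvec (f i)) 0 0) *m M *m dvec (shift (a * q) p).
  rewrite (Mdvec _ _ _ pi) mxE -mx11_scalar.
  by apply: (fix_porbit sC) => //; rewrite -(blk _ _ (fP i)).
rewrite dvec_shift; move: (dvec p) => v; rewrite -!scalemxAr !scalerA.
by rewrite divff ?expf_neq0 // !scale1r.
Qed.

Definition num_stable s := #|[set A in porbits s | stable A]|.

(** Rotations permute the orbits that are not stable, in classes of exactly d, and [rank_fix]
    identifies the number of classes with the dimension of the fixed space. *)
Theorem card_porbits s : s \in cen ->
  #|porbits s| = (d * (q - refl_len s) + num_stable s)%N.
Proof.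
move=> sC; pose X := [set A in porbits s | ~~ stable A].
have -> : #|porbits s| = (#|X| + num_stable s)%N.
  rewrite addnC -[in LHS](setID (porbits s) [set A | stable A]) cardsU.
  rewrite -[X in (_ - X)%N](_ : 0%N = _) ?subn0; last first.
    by apply/esym/eqP; rewrite cards_eq0; apply/eqP/setP => A;
       rewrite !inE; case: stable; rewrite ?andbF ?andFb.
  congr (_ + _)%N; apply: eq_card => A; first by rewrite !inE.
  by rewrite !inE andbC.
congr (_ + _)%N.
have turnX a A : A \in X -> turn a A \in X.
  rewrite !inE stable_turn => /andP[/imsetP[p _ ->] ->].
  by rewrite turn_porbit // imset_f.
pose E (A B : {set 'I_n}) := [exists a : 'I_d, turn a A == B].
have EP A B : reflect (exists a, turn a A = B) (E A B).
  apply: (iffP existsP) => [[a /eqP <-]|[a <-]]; first by exists a.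
  by exists (Ordinal (ltn_pmod a d_gt0)); rewrite /= turn_mod.
have E_equiv : {in X & &, equivalence_rel E}.
  move=> A B C _ _ _; split; first by apply/EP; exists 0%N; rewrite turn0.
  case/EP => a <-; apply/EP/EP => -[b].
    (* [d * a - a] stands for -a modulo d. *)
    move=> <-; exists (b + (d * a - a))%N.
    rewrite turnD -addnA subnK ?leq_pmull // -turnD; congr turn.
    by rewrite -turn_mod modnMr turn0.
  by rewrite turnD => <-; exists (b + a)%N.
pose P := equivalence_partition E X.
have partP : finset.partition P X := equivalence_partitionP E_equiv.
have trP := transversalP partP.
set Tr := transversal P X in trP.
have blockE := pblock_equivalence_partition E_equiv.
have [/eqP covP tiP _] := and3P partP.
have TrX A : A \in Tr -> A \in X by apply/subsetP/(transversal_sub trP).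
have -> : (q - refl_len s)%N = #|Tr|.
  rewrite /refl_len /codim_fix -mxrank_ker; apply: rank_fix => //.
  - by move=> B /TrX; rewrite inE => /andP[].
  - move=> p nst; have pX : porbit s p \in X by rewrite inE imset_f.
    have PX : pblock P (porbit s p) \in P by rewrite pblock_mem ?covP.
    set B := transversal_repr set0 Tr (pblock P (porbit s p)).
    have BTr : B \in Tr := repr_mem_transversal trP set0 PX.
    have := repr_mem_pblock trP set0 PX; rewrite -/B blockE ?(TrX _ BTr) //.
    by case/EP => a aB; exists a; rewrite aB.
  - move=> a B BTr aBTr; apply: (pblock_inj trP) => //.
    apply/esym/eqP; rewrite eq_pblock ?covP ?TrX // blockE ?TrX //.
    by apply/EP; exists a.
rewrite (card_transversal trP) mulnC; apply: card_uniform_partition partP => B.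
case/imsetP => A AX ->.
have -> : [set B in X | E A B] = [set turn (a : 'I_d) A | a in 'I_d].
  apply/setP => C; rewrite inE; apply/andP/imsetP => [[_ /existsP[a /eqP <-]]|].
    by exists a.
  by case=> a _ ->; rewrite turnX //; split=> //; apply/existsP; exists a.
rewrite card_in_imset ?card_ord // => a b _ _.
wlog ltab : a b / (a < b)%N => [hw|] ab.
  case: (ltngtP a b) => [/hw|/hw/(_ (esym ab))|/val_inj] //.
  by apply.
have := AX; rewrite inE => /andP[_ nst].
have /(stableP nst) : turn (b - a) A = A.
  by apply: (@turn_inj a); rewrite turnD subnKC // ltnW.
by rewrite gtnNdvd ?subn_gt0 // (leq_ltn_trans (leq_subr _ _) (ltn_ord b)).
Qed.

Lemma refl_len_le s : (refl_len s <= q)%N.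
Proof. exact: codim_fix_le. Qed.

End Monomial.

(** * Reflections *)

Section Swap.
Variables (F : fieldType) (n d q : nat) (z : F).
Hypotheses (q_gt0 : (0 < q)%N) (hn : n = (d * q)%N).
Hypothesis z_prim : d.-primitive_root z.
Implicit Types (s t : 'S_n) (p : 'I_n).

Local Notation cen := 'C[rot n q]%g.
Local Notation vec := (vec z q_gt0).
Local Notation Mx := (Mx q_gt0 hn z_prim).
Local Notation refl_len := (refl_len q_gt0 hn z_prim).

(* For all a, swap_fun p1 p2 exchanges p1 + a q and p2 + a q, except when
   p1 = p2 mod q: then it rotates the class of p1 and fixes the other points.
   These two cases are the two kinds of reflections of G(d,1,q). *)
Definition swap_fun p1 p2 p : 'I_n :=
  if (p == p1 %[mod q])%N then shift (n - p1 + p2) p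
  else if (p == p2 %[mod q])%N then shift (n - p2 + p1) p else p.

Lemma swap_fun1 p1 p2 a :
  swap_fun p1 p2 (shift (a * q) p1) = shift (a * q) p2.
Proof. by rewrite /swap_fun (shift_modq hn) eqxx shiftC -shift_to. Qed.

Lemma swap_fun2 p1 p2 a : ~~ (p2 == p1 %[mod q])%N ->
  swap_fun p1 p2 (shift (a * q) p2) = shift (a * q) p1.
Proof.
by move=> /negPf p21; rewrite /swap_fun (shift_modq hn) p21 eqxx shiftC -shift_to.
Qed.

Lemma swap_fun_modq p1 p2 p : (swap_fun p1 p2 p %% q)%N =
  (if (p == p1 %[mod q])%N then p2 %% q else
   if (p == p2 %[mod q])%N then p1 %% q else p %% q)%N.
Proof.
have [/esym/(modq_shift q_gt0 hn z_prim)[a ->]|pp1] := eqVneq (p %% q)%N (p1 %% q)%N.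
  by rewrite swap_fun1 (shift_modq hn).
have [/esym/(modq_shift q_gt0 hn z_prim)[a pE]|pp2] := eqVneq (p %% q)%N (p2 %% q)%N.
  have p21 : ~~ (p2 == p1 %[mod q])%N by move: pp1; rewrite pE (shift_modq hn).
  by rewrite pE swap_fun2 // (shift_modq hn).
by rewrite /swap_fun (negPf pp1) (negPf pp2).
Qed.

Lemma swap_fun_inj p1 p2 : injective (swap_fun p1 p2).
Proof.
move=> p p' e; have := congr1 (fun x : 'I_n => (x %% q)%N) e.
rewrite !swap_fun_modq => em.
have {em} pp' : p = p' %[mod q].
  by move: em; do ![case: eqP] => //; congruence.
by move: e; rewrite /swap_fun pp'; do 2?[case: eqP => _] => // /shift_inj.
Qed.

Definition swap p1 p2 : 'S_n := perm (@swap_fun_inj p1 p2).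

Lemma swap_cen p1 p2 : swap p1 p2 \in cen.
Proof.
apply: cenP => p; rewrite !permE /swap_fun.
have := shift_modq hn 1 p; rewrite mul1n => ->.
by do 2?[case: eqP => _] => //; exact: shiftC.
Qed.

Lemma swapL p1 p2 : swap p1 p2 p1 = p2.
Proof. by have := swap_fun1 p1 p2 0; rewrite mul0n !shift0 permE. Qed.

Lemma swap_refines s p : s \in cen -> refines_orbits (swap p (s p)) s.
Proof.
move=> sC x; rewrite permE.
have [/esym/(modq_shift q_gt0 hn z_prim)[a ->]|xp] := eqVneq (x %% q)%N (p %% q)%N.
  by rewrite swap_fun1 -(cen_shift _ _ sC) (mem_porbit s 1).
have [/esym/(modq_shift q_gt0 hn z_prim)[a xE]|xsp] := eqVneq (x %% q)%N (s p %% q)%N.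
  have p21 : ~~ (s p == p %[mod q])%N by move: xp; rewrite xE (shift_modq hn).
  by rewrite xE swap_fun2 // -(cen_shift _ _ sC) porbit_sym (mem_porbit s 1).
by rewrite /swap_fun (negPf xp) (negPf xsp) porbit_id.
Qed.

Lemma refl_len_swap p1 p2 : p1 != p2 -> refl_len (swap p1 p2) = 1%N.
Proof.
move=> p12; apply/eqP; rewrite eqn_leq; apply/andP; split; last first.
  rewrite lt0n; apply: contraNneq p12 => /(refl_len0 (swap_cen _ _)) e.
  by have := swapL p1 p2; rewrite e perm1 => ->.
(* Every row of the matrix of the swap minus 1 is a multiple of this single row vector. *)
apply: leq_trans (rank_leq_row (vec p2 - vec p1)).
apply/mxrankS/row_subP => i; rewrite rowE mulmxBr mulmx1 -(vec_low q_gt0 hn z_prim).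
rewrite vecM ?swap_cen //; move: (low _ _ _) => p; rewrite permE.
have [/esym/(modq_shift q_gt0 hn z_prim)[a ->]|xp] := eqVneq (p %% q)%N (p1 %% q)%N.
  by rewrite swap_fun1 !(vec_shift q_gt0 hn z_prim) -scalerBr scalemx_sub.
have [/esym/(modq_shift q_gt0 hn z_prim)[a pE]|xsp] := eqVneq (p %% q)%N (p2 %% q)%N.
  have p21 : ~~ (p2 == p1 %[mod q])%N by move: xp; rewrite pE (shift_modq hn).
  rewrite pE swap_fun2 // !(vec_shift q_gt0 hn z_prim) -scalerBr.
  by rewrite -opprB scalerN -scaleNr scalemx_sub.
by rewrite /swap_fun (negPf xp) (negPf xsp) subrr sub0mx.
Qed.

(** The quotient fixes p and its orbits refine those of s, so its fixed space contains that of s;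
    strictly, since [vec p] is fixed by the quotient but not by s. *)
Lemma refl_len_drop s p : s \in cen -> s p != p ->
  (refl_len (s * (swap p (s p))^-1)%g < refl_len s)%N.
Proof.
move=> sC sp; set r := swap p (s p); set s' := (s * r^-1)%g.
have rC : r \in cen := swap_cen _ _.
have s'C : s' \in cen by rewrite groupM ?groupV.
have s's : refines_orbits s' s.
  move=> x; rewrite permM; set y := (r^-1)%g _.
  have := swap_refines p sC y; rewrite -/r permKV => sxy.
  have := mem_porbit s 1 x; rewrite expg1 => /eq_porbit <-.
  by rewrite porbit_sym.
have sub := refines_fix q_gt0 hn z_prim s'C sC s's.
suff : (\rank (kermx (Mx s - 1%:M)) < \rank (kermx (Mx s' - 1%:M)))%N.
  rewrite !mxrank_ker -!/(codim_fix _) -!/(refl_len _).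
  have := refl_len_le q_gt0 hn z_prim s; lia.
rewrite rank_ltmx // ltmxE sub /=; apply: contraNN sp => sub'.
have /submx_trans/(_ sub')/fixP : (vec p <= kermx (Mx s' - 1%:M))%MS.
  apply/fixP; rewrite vecM // permM; congr vec.
  by rewrite -{1}(swapL p (s p)) permK.
by rewrite vecM // => /(vec_inj hn z_prim) ->.
Qed.

(** Reflections are split off one at a time with [refl_len_drop]; by subadditivity each of them
    lowers the length by exactly 1. *)
Lemma refl_word s : s \in cen -> exists rs : seq 'S_n,
  [/\ size rs = refl_len s,
      forall r, r \in rs -> r \in cen /\ refl_len r = 1%N &
      (\prod_(r <- rs) r)%g = s].
Proof.
have [k le_k] := ubnP (refl_len s); elim: k s le_k => // k IHk s le_k sC.
have [s1|/existsP[p sp]] := boolP [forall p, s p == p].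
  have -> : s = 1%g by apply/permP => p; rewrite perm1; apply/eqP/(forallP s1).
  exists [::]; split=> //; last by rewrite big_nil.
  by rewrite /= /refl_len /codim_fix Mx1 subrr mxrank0.
have lt_s := refl_len_drop sC sp.
set r := swap p (s p) in lt_s; set s' := (s * r^-1)%g in lt_s.
have rC : r \in cen := swap_cen _ _.
have r1 : refl_len r = 1%N by apply: refl_len_swap; rewrite eq_sym.
have [||rs [sz rsP rsE]] := IHk s'; first exact: leq_trans lt_s _.
  by rewrite groupM ?groupV.
exists (rcons rs r); split.
- rewrite size_rcons sz; have : (refl_len (s' * r)%g <= refl_len s' + 1)%N.
    by rewrite -r1 refl_lenM ?groupM ?groupV.
  rewrite /s' mulgKV -/s'; lia.
- by move=> x; rewrite mem_rcons inE => /orP[/eqP ->|/rsP].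
- by rewrite -cats1 big_cat big_seq1 /= rsE mulgKV.
Qed.

End Swap.

(** * Absolute length in the symmetric group *)

Section AbsoluteLength.
Variable n : nat.
Hypothesis n_gt0 : (0 < n)%N.
Implicit Types (s t : 'S_n) (p : 'I_n).

Definition abs_len s := (n - #|porbits s|)%N.
Definition abs_below s t := (abs_len s + abs_len (s^-1 * t)%g)%N = abs_len t.

Lemma card_porbits_le s : (#|porbits s| <= n)%N.
Proof. by rewrite (leq_trans (leq_imset_card _ _)) ?card_ord. Qed.

(* The symmetric group is the case d = 1, q = n, z = 1, over the rationals. *)
Lemma one_prim : 1.-primitive_root (1 : rat).
Proof.
apply/andP; split=> //; apply/forallP => i.
by rewrite ord1 unity_rootE expr1n eqxx.
Qed.

Let e1n : n = (1 * n)%N := esym (mul1n n).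
Local Notation len1 := (refl_len n_gt0 e1n one_prim).

Lemma cen1 s : s \in 'C[rot n n]%g.
Proof. by apply: cenP => p; rewrite !shiftn. Qed.

(** For d = 1 no orbit is stable, and [card_porbits] equates the number of cycles with the dimension
    of the fixed space. *)
Lemma abs_lenE s : abs_len s = len1 s.
Proof.
have := card_porbits n_gt0 e1n one_prim (cen1 s).
have -> : num_stable 1 n s = 0%N.
  apply/eqP; rewrite cards_eq0; apply/eqP/setP => A; rewrite !inE.
  by apply/negbTE/negP => /andP[_ /existsP[a]]; rewrite ord1.
have := refl_len_le n_gt0 e1n one_prim s; rewrite /abs_len; lia.
Qed.

Lemma abs_belowE s t : abs_below s t = below n_gt0 e1n one_prim s t.
Proof. by rewrite /abs_below !abs_lenE. Qed.

Lemma abs_lenM s t : (abs_len (s * t)%g <= abs_len s + abs_len t)%N.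
Proof. by rewrite !abs_lenE refl_lenM ?cen1. Qed.

Lemma abs_len_quot s t : (abs_len t <= abs_len s + abs_len (s^-1 * t)%g)%N.
Proof. by rewrite -{1}(mulKVg s t) abs_lenM. Qed.

Lemma abs_below_compl s t : abs_below s t -> abs_below (s^-1 * t)%g t.
Proof. by rewrite !abs_belowE; apply: below_compl; exact: cen1. Qed.

(** The sum over the t-orbit of p is fixed by t, hence by s; its value is 1 at p, hence also at s p,
    whereas it vanishes off that orbit. *)
Lemma abs_below_refines s t : abs_below s t -> refines_orbits s t.
Proof.
rewrite abs_belowE => /(below_fix (cen1 _) (cen1 _)) sub p.
have nst (A : {set 'I_n}) : ~~ stable 1 n A.
  by apply/negP => /existsP[a]; rewrite ord1.
have := submx_trans (orbit_sum_fix n_gt0 e1n one_prim p (cen1 t)) sub.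
move=> /(fix_dvecP _ _ _ _ (cen1 s))/(_ p).
rewrite (orbit_sum_dvec n_gt0 e1n one_prim (cen1 t) (nst _) (porbit_id t p)) => e.
apply/negPn/negP => sp; move: e; rewrite (orbit_sum_dvec0 n_gt0 e1n one_prim) => [|a].
  by move/matrixP/(_ 0 0); rewrite !mxE => /eqP; rewrite eq_sym oner_eq0.
apply: contra sp => /imsetP[p' p'p ->].
by rewrite -[(a * n)%N]addn0 shiftM shift0.
Qed.

Lemma odd_abs_len s : odd (abs_len s) = s.
Proof. by rewrite oddB ?card_porbits_le // /odd_perm card_ord. Qed.

Lemma abs_len_tperm s x y : x != y -> x \in porbit s y ->
  (abs_len (tperm x y * s)%g).+1 = abs_len s.
Proof.
move=> xy xsy; have := porbits_mul_tperm s x y; rewrite xy xsy /=.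
have := card_porbits_le (tperm x y * s)%g; rewrite /abs_len double0 addn0.
move: #|porbits (tperm x y * s)%g| #|porbits s| => a b; lia.
Qed.

(** The common factor cancels in s^-1 t, and both lengths drop by 1 because x and y share an orbit
    of s, hence one of t. *)
Lemma abs_below_tperm s t x y : x != y -> x \in porbit s y ->
  abs_below s t -> abs_below (tperm x y * s)%g (tperm x y * t)%g.
Proof.
move=> xy xsy st; have := abs_len_tperm xy xsy.
have xty : x \in porbit t y.
  move/porbitP: xsy => [k ->]; elim: k => [|k IHk]; first by rewrite expg0 perm1 porbit_id.
  rewrite expgSr permM -(eq_porbit IHk); exact: abs_below_refines.
have := abs_len_tperm xy xty; move: st; rewrite /abs_below invMg !mulgA mulgKV.
move: (abs_len (_ * s)%g) (abs_len (_ * t)%g) (abs_len s) (abs_len t).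
move: (abs_len _) => a b c e f; lia.
Qed.

(** Cutting the circle before the point 0 is harmless: crossing chords have interlaced ends in the
    linear order too. For an equivalence relation the conclusion puts both chords in one class. *)
Definition noncrossing (e : rel 'I_n) := forall x y z t : 'I_n,
  (x < y)%N -> (y < z)%N -> (z < t)%N -> e x z -> e y t -> e x y.

(** Multiplying by the transposition of x and z splits the n-cycle into two arcs, which the modified
    s preserves. An orbit of s through y and t that avoids x and z is left unchanged, yet it would
    join the two arcs. *)
Lemma abs_below_noncrossing s : abs_below s (rot n 1) ->
  noncrossing (fun x y => y \in porbit s x).
Proof.
move=> sc x y z t xy yz zt xz yt; apply/negPn/negP => nxy.
have xz' : x != z by rewrite neq_ltn (ltn_trans xy yz).
have := abs_below_tperm xz' _ sc; rewrite porbit_sym => /(_ xz).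
set s' := (_ * s)%g; set c' := (_ * rot n 1)%g => s'c'.
(* The arc (x, z] is invariant under c', hence under s'. *)
pose D := [set p : 'I_n | (x < p <= z)%N].
have xz_lt := ltn_trans xy yz.
have Dc' p : (c' p \in D) = (p \in D).
  have [->|px] := eqVneq p x.
    rewrite permM tpermL rotE !inE /= ltnn /= addn1.
    by rewrite modn_small ?(leq_ltn_trans zt) ?ltnn ?andbF.
  have [->|pz] := eqVneq p z.
    rewrite permM tpermR rotE !inE /= addn1.
    by rewrite modn_small ?(leq_ltn_trans xz_lt) // ltnSn xz_lt leqnn.
  rewrite permM tpermD 1?eq_sym // rotE !inE /= addn1.
  have : (p < n)%N by []; rewrite leq_eqVlt => /orP[/eqP pn|pn].
    by rewrite pn modnn /=; apply/esym/negbTE; have := ltn_ord t; lia.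
  rewrite modn_small //; move: px pz; rewrite -!val_eqE /= => px pz.
  by apply/andP/andP => -[]; split; lia.
have Dk k p : ((c' ^+ k)%g p \in D) = (p \in D).
  by elim: k => [|k IHk]; rewrite ?expg0 ?perm1 // expgSr permM Dc' IHk.
have Ds' k p : ((s' ^+ k)%g p \in D) = (p \in D).
  elim: k => [|k IHk]; rewrite ?expg0 ?perm1 // expgSr permM -IHk.
  by have /porbitP[j ->] := abs_below_refines s'c' ((s' ^+ k)%g p); rewrite Dk.
case/porbitP: yt => k tE.
have {tE} tE : t = (s' ^+ k)%g y.
  rewrite tE; elim: (k) => [|j IHj]; first by rewrite !expg0.
  rewrite !expgSr !permM -IHj tpermD //.
    by apply: contraNneq nxy => ->; rewrite porbit_sym mem_porbit.
  apply: contraNneq nxy => e; rewrite porbit_sym.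
  by rewrite -(eq_porbit (mem_porbit s j y)) -e porbit_sym.
by have := Ds' k y; rewrite -tE !inE; lia.
Qed.

End AbsoluteLength.

(** * Comparison of the absolute orders of G(d,1,q) and the symmetric group *)

Section Comparison.
Variables (F : fieldType) (n d q : nat) (z : F).
Hypotheses (q_gt0 : (0 < q)%N) (hn : n = (d * q)%N).
Hypothesis z_prim : d.-primitive_root z.
Implicit Types (s t : 'S_n) (p : 'I_n).

Local Notation cen := 'C[rot n q]%g.
Local Notation refl_len := (refl_len q_gt0 hn z_prim).
Local Notation below := (below q_gt0 hn z_prim).
Local Notation num_stable := (num_stable d q).

Let n_gt0 : (0 < n)%N.
Proof. by rewrite hn muln_gt0 q_gt0 (prim_order_gt0 z_prim). Qed.

Lemma abs_len_refl_len s : s \in cen ->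
  (abs_len s + num_stable s = d * refl_len s)%N.
Proof.
move=> sC; have := card_porbits q_gt0 hn z_prim sC.
have := refl_len_le q_gt0 hn z_prim s; have := card_porbits_le s.
rewrite /abs_len; move: (#|_|) (refl_len s) (num_stable s) => k r e kn rq kE.
have : (d * r <= n)%N by rewrite hn leq_mul2l rq orbT.
have := mulnBr d q r; rewrite -hn; lia.
Qed.

(* With b = s^-1 t, the number abs_len s + abs_len b - abs_len t equals
   num_stable t - num_stable s - num_stable b <= 1; it is nonnegative, and even
   because the parity of abs_len is the sign. *)
Lemma below_abs_below s t : s \in cen -> t \in cen -> (num_stable t <= 1)%N ->
  below s t -> abs_below s t.
Proof.
move=> sC tC t1; set b := (s^-1 * t)%g.
have bC : b \in cen by rewrite groupM ?groupV.
rewrite /below -/b /abs_below -/b => e.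
have := abs_len_refl_len sC; have := abs_len_refl_len tC.
have := abs_len_refl_len bC; rewrite -e mulnDr.
have := abs_len_quot n_gt0 s t; rewrite -/b.
have : odd (abs_len t) = odd (abs_len s + abs_len b).
  by rewrite oddD !odd_abs_len -odd_permM mulKVg.
lia.
Qed.

Lemma num_stable_d1 s : d = 1%N -> num_stable s = 0%N.
Proof.
move=> d1; apply/eqP; rewrite cards_eq0; apply/eqP/setP => A; rewrite !inE.
apply/negbTE/negP => /andP[_ /existsP[a /andP[]]].
by have := ltn_ord a; rewrite {2}d1; case: (val a).
Qed.

(* The multiple d * (refl_len s + refl_len b - refl_len t) of d equals
   num_stable s + num_stable b - num_stable t <= 1; all num_stable vanish when
   d = 1. *)
Lemma abs_below_below s t : s \in cen -> t \in cen ->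
  (num_stable s <= num_stable t)%N -> (num_stable (s^-1 * t)%g <= 1)%N ->
  abs_below s t -> below s t.
Proof.
move=> sC tC; set b := (s^-1 * t)%g => st b1.
have bC : b \in cen by rewrite groupM ?groupV.
rewrite /below -/b /abs_below -/b => e.
have := abs_len_refl_len sC; have := abs_len_refl_len tC.
have := abs_len_refl_len bC; have := refl_len_quot q_gt0 hn z_prim sC tC; rewrite -/b.
have := num_stable_d1 s; have := num_stable_d1 t; have := num_stable_d1 b.
have := prim_order_gt0 z_prim.
move: (refl_len s) (refl_len b) (refl_len t) st b1 e => rs rb rt.
move: (num_stable s) (num_stable b) (num_stable t) => ns nb nt.
move: (abs_len s) (abs_len b) (abs_len t) => ls lb lt st b1 e.
move=> d_gt0 eb et es le1 eB eT eS.
have : (d * (rs + rb - rt) <= 1)%N by rewrite mulnBr mulnDr; lia.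
have le_d1 : (d * (rs + rb - rt) <= 1)%N by rewrite mulnBr mulnDr; lia.
case: (ltnP 1 d) => d1; last first.
  have d1' : d = 1%N by lia.
  by have := eb d1'; have := es d1'; have := et d1'; move: eB eT eS; rewrite d1'; lia.
(* For d > 1 a multiple of d that is at most 1 vanishes. *)
move: le_d1; case e0: (rs + rb - rt)%N => [|k]; [lia|rewrite mulnS; lia].
Qed.

Lemma num_stable_rot1 : (1 < d)%N -> num_stable (rot n 1) = 1%N.
Proof.
move=> d1; rewrite /num_stable porbits_rot1 //.
rewrite (_ : [set _ in _ | _] = [set [set: 'I_n]]) ?cards1 //.
apply/setP => A; rewrite !inE; case: eqP => //= ->.
apply/existsP; exists (Ordinal d1) => /=.
rewrite eqEsubset subsetT; apply/subsetP => p _; apply/imsetP.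
exists (shift (n - 1 * q) p); rewrite ?inE // shiftD subnK ?shiftn //.
by rewrite hn leq_mul2r (ltnW d1) orbT.
Qed.

Lemma rot_cen k : rot n k \in cen.
Proof. by apply/cent1P; exact: rotC. Qed.

Lemma num_stable_rot1_le : (num_stable (rot n 1) <= 1)%N.
Proof.
have := prim_order_gt0 z_prim; rewrite leq_eqVlt => /orP[/eqP d1|/num_stable_rot1 -> //].
by rewrite num_stable_d1.
Qed.

End Comparison.

(** * The permutation attached to a noncrossing partition *)

Section NextInBlock.
Variables (n : nat) (P : {set {set 'I_n}}).
Hypotheses (n_gt0 : (0 < n)%N) (partP : finset.partition P [set: 'I_n]).
Implicit Types x y z m : 'I_n.

Local Notation blk := (finset.pblock P).

Lemma mem_blk x : x \in blk x.
Proof. by have /and3P[/eqP cP _ _] := partP; rewrite mem_pblock cP inE. Qed.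

Lemma eq_blk x y : y \in blk x -> blk y = blk x.
Proof. by have /and3P[_ tP _] := partP; exact: same_pblock. Qed.

Lemma blk_sym x y : (y \in blk x) = (x \in blk y).
Proof. by apply/idP/idP => /eq_blk ->; exact: mem_blk. Qed.

Lemma gap_subproof x : exists k, shift k.+1 x \in blk x.
Proof. by exists n.-1; rewrite prednK // shiftn mem_blk. Qed.

(** The next point of the block of x in cyclic direction is [gap x + 1] steps away; for a singleton
    block this is a full turn. *)
Definition gap x := ex_minn (gap_subproof x).

Lemma gap_mem x : shift (gap x).+1 x \in blk x.
Proof. by rewrite /gap; case: ex_minnP. Qed.

Lemma gap_min x k : shift k.+1 x \in blk x -> (gap x <= k)%N.
Proof. by rewrite /gap; case: ex_minnP => m _ + /[dup] => /[apply]. Qed.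

Definition next_fun x := shift (gap x).+1 x.

(** If x and y had the same successor and x the smaller gap, then x would lie between y and this
    successor, in the block of y, against the minimality of [gap y]. *)
Lemma next_fun_inj : injective next_fun.
Proof.
have lt_inj x y : (gap x < gap y)%N -> next_fun x <> next_fun y.
  move=> lt_xy e; have : shift (gap y - gap x) y = x.
    apply: (@shift_inj _ (gap x).+1); rewrite shiftD -[RHS]/(next_fun x) e /next_fun.
    by congr shift; lia.
  have -> : (gap y - gap x = (gap y - gap x).-1.+1)%N by lia.
  move=> xE; have : shift (gap y - gap x).-1.+1 y \in blk y.
    rewrite xE; have := gap_mem x; rewrite -/(next_fun x) e => yx.
    by rewrite -(eq_blk (gap_mem y)) (eq_blk yx) mem_blk.
  by move/gap_min; lia.
move=> x y e; case: (ltngtP (gap x) (gap y)) => [/lt_inj//|/lt_inj|gxy].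
  by move/(_ (esym e)).
by move: e; rewrite /next_fun gxy => /shift_inj.
Qed.

Definition next : 'S_n := perm next_fun_inj.

Lemma next_mem x : next x \in blk x.
Proof. by rewrite permE; exact: gap_mem. Qed.

Lemma porbit_next x : porbit next x = blk x.
Proof.
apply/setP => y; apply/idP/idP => [/porbitP[k ->]|].
  elim: k => [|k IHk]; first by rewrite expg0 perm1 mem_blk.
  by rewrite expgSr permM -(eq_blk IHk) next_mem.
have [k ->] : exists k, y = shift k x by eexists; exact: shift_to.
have [K lek] := ubnP k; elim: K k lek x => // K IHK [_ x _|k leK x kx].
  by rewrite shift0 porbit_id.
have le_gap := gap_min kx.
have e : shift k.+1 x = shift (k - gap x) (next x).
  by rewrite permE shiftD; congr shift; lia.
rewrite e; have := mem_porbit next 1 x; rewrite expg1 => /eq_porbit <-.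
by apply: IHK; [lia|rewrite -e (eq_blk (next_mem x))].
Qed.

Lemma porbits_next : porbits next = P.
Proof.
have /and3P[/eqP cP tP P0] := partP.
apply/setP => A; apply/imsetP/idP => [[x _ ->]|AP].
  by rewrite porbit_next pblock_mem // cP inE.
have /set0Pn[x xA] : A != set0 by apply: contraNneq P0 => <-.
by exists x => //; rewrite porbit_next (def_pblock tP AP).
Qed.

Lemma next_shift k : (forall x y, (shift k y \in blk (shift k x)) = (y \in blk x)) ->
  forall x, next (shift k x) = shift k (next x).
Proof.
move=> inv x; rewrite !permE /next_fun [RHS]shiftC; congr (shift _.+1 _).
by apply/eq_ex_minn => m; rewrite shiftC inv.
Qed.

Hypothesis ncP : noncrossing (fun x y => y \in blk x).

Let e1n : n = (1 * n)%N := esym (mul1n n).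
Local Notation Mx := (Mx n_gt0 e1n one_prim).
Local Notation vec := (vec (1 : rat) n_gt0).

Let o0 : 'I_n := Ordinal n_gt0.

(* The last points of the blocks that do not contain 0.  Every other jump below
   is a telescoping sum of jumps at such points, so that next^-1 * rot 1 moves a
   space of dimension less than #|P|. *)
Definition closing := [set m : 'I_n | (o0 \notin blk m) &&
  [forall y, (y \in blk m) ==> (y <= m)%N]].

Lemma closingP m :
  reflect (o0 \notin blk m /\ forall y, y \in blk m -> (y <= m)%N)
          (m \in closing).
Proof.
rewrite inE; apply: (iffP andP) => -[m0 mm]; split=> //.
  by move=> y; apply/implyP/(forallP mm).
by apply/forallP => y; apply/implyP/mm.
Qed.

Lemma card_closing : (#|closing| < #|P|)%N.
Proof.
have /and3P[/eqP cP tP P0] := partP.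
have Pb x : blk x \in P by rewrite pblock_mem // cP inE.
rewrite (cardsD1 (blk o0)) Pb add1n ltnS.
have inj_blk : {in closing &, injective (fun x => blk x)}.
  move=> x y /closingP[_ xm] /closingP[_ ym] e; apply/val_inj/eqP.
  by rewrite eqn_leq ym ?xm -?e ?mem_blk // e mem_blk.
rewrite -(card_in_imset inj_blk); apply/subset_leq_card/subsetP => A /imsetP[m].
case/closingP => m0 _ ->; rewrite !inE Pb andbT.
by apply: contraNneq m0 => ->; exact: mem_blk.
Qed.

(** Row x of the matrix of [next] minus that of the n-cycle; [vec] reads x + 1 modulo n. *)
Definition jump x : 'rV[rat]_n := vec (next x) - vec x.+1.

Definition jumps : 'M[rat]_(#|closing|, n) := \matrix_i jump (enum_val i).

Lemma jump_closing m : m \in closing -> (jump m <= jumps)%MS.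
Proof.
move=> mC; have -> : jump m = row (enum_rank_in mC m) jumps.
  by rewrite rowK enum_rankK_in.
exact: row_sub.
Qed.

Section Arc.
Variable x : 'I_n.
(** The successor of x before reduction modulo n. Under [x'n] the step may end at the point 0, with
    x' = n, but does not go beyond it. *)
Let x' := (x + (gap x).+1)%N.
Hypothesis x'n : (x' <= n)%N.

Lemma arc_notin y : (x < y < x')%N -> y \notin blk x.
Proof.
case/andP=> xy yx'; apply/negP => yB.
have yE : y = shift (y - x).-1.+1 x.
  by apply: val_inj => /=; rewrite prednK ?subn_gt0 // subnKC ?modn_small // ltnW.
by have := @gap_min x (y - x).-1; rewrite -yE yB /x' => /(_ isT); lia.
Qed.

(** A block meeting the open arc and leaving it would cross the block of x. *)
Lemma arc_block y b : (x < y < x')%N -> b \in blk y -> (x < b < x')%N.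
Proof.
move=> xyx' by_; have yNx := arc_notin xyx'.
have bNx : b \notin blk x.
  by apply: contra yNx => bx; rewrite -(eq_blk bx) (eq_blk by_) mem_blk.
have {xyx'} [xy yx'] := andP xyx'.
have bx : b != x :> nat by apply: contraNneq bNx => /val_inj ->; exact: mem_blk.
case: (ltngtP x' n) => [x'_lt||x'E]; last first.
- (* Here the arc from x to next x ends at the point 0. *)
  have x0 : o0 \in blk x.
    suff <- : shift (gap x).+1 x = o0 by exact: gap_mem.
    by apply: val_inj; rewrite /= -/x' x'E modnn.
  have b0 : b != o0 by apply: contraNneq bNx => ->.
  rewrite x'E ltn_ord andbT ltnNge; apply/negP => le_bx.
  have bx' : (b < x)%N by rewrite ltn_neqAle bx.
  have b_gt0 : (o0 < b)%N by rewrite lt0n.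
  case/negP: bNx; rewrite -(eq_blk x0).
  by apply: (ncP b_gt0 bx' xy); rewrite // blk_sym.
- by rewrite ltnNge x'n.
have x'B : Ordinal x'_lt \in blk x.
  suff <- : shift (gap x).+1 x = Ordinal x'_lt by exact: gap_mem.
  by apply: val_inj; rewrite /= -/x' modn_small.
have bx' : b != x' :> nat.
  by apply: contraNneq bNx => be; have -> : b = Ordinal x'_lt by apply: val_inj.
apply/andP; split; rewrite ltnNge; apply/negP => le_b.
  have bx2 : (b < x)%N by rewrite ltn_neqAle bx.
  case/negP: bNx; rewrite blk_sym.
  by apply: (ncP bx2 xy (yx' : (y < Ordinal x'_lt)%N)); rewrite // blk_sym.
have x'b : (Ordinal x'_lt < b)%N by rewrite ltn_neqAle eq_sym bx'.
case/negP: yNx.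
exact: (ncP xy (yx' : (y < Ordinal x'_lt)%N) x'b).
Qed.

(* The hypothesis on y says that the points between x and y form a union of
   blocks; the next step jumps over the whole block whose first point is y. *)
Lemma arc_telescope k (y : nat) : (x' - y <= k)%N -> (x < y <= x')%N ->
  (forall p b : 'I_n, (x < p < y)%N -> b \in blk p -> (b < y)%N) ->
  (vec y - vec x' <= jumps)%MS.
Proof.
elim: k y => [|k IHk] y le_k /andP[xy yx'] sat.
  have -> : y = x' by lia.
  by rewrite subrr sub0mx.
move: yx'; rewrite leq_eqVlt => /orP[/eqP ->|yx']; first by rewrite subrr sub0mx.
have y_lt : (y < n)%N := leq_trans yx' x'n.
pose yo := Ordinal y_lt.
have in_yo : (x < yo < x')%N by rewrite /= xy.
case: (@arg_maxnP _ yo (mem (blk yo)) val (mem_blk yo)) => m /= m_yo m_max.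
have in_m := arc_block in_yo m_yo.
have y_min b : b \in blk yo -> (y <= b)%N.
  move=> b_yo; rewrite leqNgt; apply/negP => b_lt.
  have /andP[xb _] := arc_block in_yo b_yo.
  have := sat b yo; rewrite xb b_lt /= -blk_sym b_yo ltnn.
  by move/(_ isT isT).
have blkm : blk m = blk yo := eq_blk m_yo.
have ym : (y <= m)%N := y_min _ m_yo.
have mC : m \in closing.
  apply/closingP; rewrite blkm; split; last by move=> b /m_max.
  by apply/negP => /(arc_block in_yo); case/andP.
(* The last point m is followed by the first point y: y is n - m + y steps away, and a point of the
   block met sooner would be larger than m or smaller than y. *)
have nextm : next m = yo.
  have := next_mem m; rewrite blkm => nm; apply/val_inj/eqP.
  rewrite eqn_leq y_min // andbT.
  have : (gap m <= n - m + y.-1)%N.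
    apply: gap_min; rewrite blkm.
    have -> : (n - m + y.-1).+1 = (n - m + yo)%N by rewrite /=; lia.
    by rewrite -shift_to mem_blk.
  have := m_max _ nm; rewrite permE /= => m_ge gm.
  have gmn : (n <= m + (gap m).+1)%N.
    rewrite leqNgt; apply/negP => lt_n; move: m_ge; rewrite modn_small //; lia.
  have -> : (m + (gap m).+1 = n + (m + (gap m).+1 - n))%N by lia.
  have := ltn_ord m; rewrite modnDl modn_small; lia.
have -> : vec y - vec x' = jump m + (vec m.+1 - vec x').
  by rewrite /jump nextm addrA subrK.
apply: addmx_sub; first exact: jump_closing.
apply: IHk; try lia.
(* Saturation up to m + 1: the block of a point strictly between y and m cannot pass m without
   crossing the block of y. *)
move=> p b /andP[xp]; rewrite ltnS => pm b_p; rewrite ltnS.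
have [p_y|y_p] := ltnP p y.
  have := sat p b; rewrite xp p_y b_p => /(_ isT isT); lia.
have [p_yo|pNyo] := boolP (p \in blk yo).
  by apply: m_max; rewrite -(eq_blk p_yo).
have in_p : (x < p < x')%N by lia.
have in_b := arc_block in_p b_p.
rewrite leqNgt; apply/negP => mb; case/negP: pNyo.
have p_m : (p < m)%N.
  rewrite ltn_neqAle pm andbT; apply: contraTneq mb => /val_inj pm'.
  by rewrite -leqNgt; apply: m_max; rewrite -blkm -pm'.
have yo_p : (yo < p)%N.
  rewrite ltn_neqAle y_p andbT; apply: contraTneq mb => yp.
  have {yp} yp : yo = p by apply: val_inj.
  by rewrite -leqNgt; apply: m_max; rewrite yp.
exact: (ncP yo_p p_m mb).
Qed.

Lemma jump_arc : (jump x <= jumps)%MS.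
Proof.
rewrite -eqmx_opp /jump opprB permE (vec_mod n_gt0 e1n one_prim).
by apply: (@arc_telescope (x' - x.+1)) => //; [rewrite /x'; lia|move=> p b; lia].
Qed.

End Arc.

(** A step that goes beyond the point 0 starts at a closing point, since 0 or any later point of the
    block would have been met sooner. *)
Lemma jump_sub x : (jump x <= jumps)%MS.
Proof.
have [x'n|n_lt] := leqP (x + (gap x).+1)%N n; first exact: jump_arc.
apply: jump_closing; apply/closingP; split.
  apply/negP => x0; have : (gap x <= (n - x).-1)%N.
    apply: gap_min; rewrite prednK ?subn_gt0 //.
    by have := shift_to x o0; rewrite addn0 => <-.
  have := ltn_ord x; lia.
move=> y yx; rewrite leqNgt; apply/negP => xy.
have : (gap x <= (y - x).-1)%N.
  apply: gap_min; rewrite prednK ?subn_gt0 //.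
  have -> // : shift (y - x) x = y.
  by apply: val_inj; rewrite /= subnKC ?modn_small // ltnW.
have := ltn_ord y; lia.
Qed.

(** The lengths are n - #|P| for [next], n - 1 for the cycle and, by the rank bound, at most #|P| -
    1 for the quotient; subadditivity forces equality. *)
Theorem next_abs_below : abs_below next (rot n 1).
Proof.
have le_P : (abs_len (next^-1 * rot n 1)%g < #|P|)%N.
  rewrite (abs_lenE n_gt0) refl_len_quotE ?cen1 //.
  apply: leq_ltn_trans card_closing; apply: leq_trans (rank_leq_row jumps).
  apply/mxrankS/row_subP => i; rewrite rowE mulmxBr.
  rewrite -(vec_low n_gt0 e1n one_prim) !vecM ?cen1 //.
  by rewrite rotE (vec_mod n_gt0 e1n one_prim) addn1; exact: jump_sub.
apply/eqP; rewrite eqn_leq [X in _ && X](abs_len_quot n_gt0) andbT.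
move: le_P; rewrite {2 4}/abs_len porbits_next porbits_rot1 // cards1.
have := card_porbits_le next; rewrite porbits_next.
move: (abs_len _) #|P| => a b; lia.
Qed.

End NextInBlock.

(** * Separation of two blocks by a chord *)

Section Blocks.
Variable n : nat.
Implicit Types (P : {set {set 'I_n}}) (A B : {set 'I_n}) (x y : 'I_n).

Local Notation blk := finset.pblock.

Lemma partition_porbits (s : 'S_n) : partition (porbits s) [set: 'I_n].
Proof.
apply/and3P; split.
- rewrite eqEsubset subsetT; apply/subsetP => x _; apply/bigcupP.
  by exists (porbit s x); rewrite ?imset_f ?porbit_id.
- apply/trivIsetP => _ _ /imsetP[x _ ->] /imsetP[y _ ->]; apply: contraNT.
  case/pred0Pn => z /andP[/= zx zy].
  by rewrite -(eq_porbit zx) -(eq_porbit zy).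
- by apply/imsetP => -[x _ e]; have := porbit_id s x; rewrite -e inE.
Qed.

Lemma pblock_porbits (s : 'S_n) x : blk (porbits s) x = porbit s x.
Proof.
have /and3P[_ tP _] := partition_porbits s.
by rewrite (def_pblock tP _ (porbit_id s x)) // imset_f.
Qed.

Lemma min_block A : A != set0 ->
  exists2 a : 'I_n, a \in A & forall x, x \in A -> (a <= x)%N.
Proof.
case/set0Pn => x0 x0A; case: (@arg_minnP _ x0 (mem A) val x0A) => a aA am.
by exists a.
Qed.

(** Here a is the last point of A before [b0], and b the first point of A after [b0] or, if there is
    none, [a0] one turn later. The last clause says that x or n + x lies in [b, n + a], the arc
    opposite to B. *)
Lemma noncrossing_separated P A B (a0 b0 : 'I_n) :
  partition P [set: 'I_n] -> noncrossing (fun x y => y \in blk P x) ->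
  A \in P -> B \in P -> A != B ->
  a0 \in A -> (forall x, x \in A -> (a0 <= x)%N) ->
  b0 \in B -> (forall x, x \in B -> (b0 <= x)%N) -> (a0 < b0)%N ->
  exists a b : nat, [/\ (a <= b <= a + n)%N,
    (forall x, x \in B -> (a < x < b)%N) &
    forall x, x \in A -> (x <= a /\ b <= n + x)%N \/ (b <= x <= n + a)%N].
Proof.
move=> partP nc AP BP AB a0A a0min b0B b0min ab0.
have /and3P[_ tP _] := partP.
have blkA x : x \in A -> blk P x = A by exact: def_pblock.
have blkB x : x \in B -> blk P x = B by exact: def_pblock.
have neqAB x y : x \in A -> y \in B -> x != y.
  by move=> xA yB; apply: contraNneq AB => xy; rewrite -(blkA x xA) xy blkB.
case: (@arg_maxnP _ a0 [pred x in A | (x < b0)%N] val); first by rewrite /= a0A.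
move=> a1 /andP[/= a1A a1b0] a1max.
have [/existsP[u /andP[uA b0u]]|/existsPn nA] := boolP [exists u in A, (b0 < u)%N].
  case: (@arg_minnP _ u [pred x in A | (b0 < x)%N] val); first by rewrite /= uA.
  move=> a2 /andP[/= a2A b0a2] a2min; exists a1, a2; split.
  - rewrite (ltnW (ltn_trans a1b0 b0a2)).
    exact: leq_trans (ltnW (ltn_ord a2)) (leq_addl _ _).
  - move=> b bB; apply/andP; split; first exact: leq_trans a1b0 (b0min _ bB).
    rewrite ltnNge leq_eqVlt negb_or; apply/andP; split.
      by apply: contraNneq (neqAB _ _ a2A bB) => /val_inj ->.
    apply/negP => a2b; have : b0 \in blk P a1.
      apply: (nc _ _ _ _ a1b0 b0a2 a2b); first by rewrite blkA.
      by rewrite (blkB _ b0B).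
    by rewrite blkA // => b0A; have := neqAB _ _ b0A b0B; rewrite eqxx.
  - move=> x xA; have := neqAB _ _ xA b0B; rewrite -val_eqE /= neq_ltn.
    case/orP => [xb0|b0x].
      left; split; first by apply: a1max; rewrite /= xA.
      exact: leq_trans (ltnW (ltn_ord a2)) (leq_addr _ _).
    right; rewrite a2min /= ?xA //.
    exact: leq_trans (ltnW (ltn_ord x)) (leq_addr _ _).
have A_lt x : x \in A -> (x < b0)%N.
  move=> xA; have := nA x; rewrite xA /= -leqNgt leq_eqVlt => /orP[|//].
  by move/eqP/val_inj => xb0; have := neqAB _ _ xA b0B; rewrite xb0 eqxx.
exists a1, (n + a0)%N; split.
- by rewrite (leq_trans (ltnW (ltn_ord a1)) (leq_addr _ _)) addnC leq_add2r a0min.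
- move=> b bB; rewrite (leq_trans a1b0 (b0min _ bB)) /=.
  exact: leq_trans (ltn_ord b) (leq_addr _ _).
- move=> x xA; left; rewrite leq_add2l a0min //; split=> //.
  by apply: a1max; rewrite /= xA A_lt.
Qed.

End Blocks.

Require Import Defs.
From mathcomp Require Import classical_sets functions reals trigo.

Import Order.TTheory Num.Theory.
Local Open Scope complex_scope.

(** * Primitive complex roots of unity *)

Section Zeta.
Variable R : realType.

Lemma zetaX m k : zeta R m ^+ k =
  Complex (cos (2 * pi / m%:R *+ k)) (sin (2 * pi / m%:R *+ k)).
Proof.
elim: k => [|k IHk]; first by rewrite expr0 mulr0n cos0 sin0.
rewrite exprSr IHk /zeta [_ *+ k.+1]mulrSr cosD sinD; apply/eqP; rewrite eq_complex /=.
by apply/andP; split; apply/eqP; ring.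
Qed.

Lemma zeta_prim m : (0 < m)%N -> m.-primitive_root (zeta R m).
Proof.
move=> m_gt0; have m0 : (m%:R : R) != 0 by rewrite pnatr_eq0 -lt0n.
apply/andP; split=> //; apply/forallP => i; rewrite unity_rootE; apply/eqP.
have [->|im] := eqVneq i.+1 m.
  rewrite zetaX -mulr_natr divfK // mulr_natl cos2pi sin2pi.
  by rewrite !eqxx.
apply/negbTE; rewrite zetaX eq_complex /= negb_and; apply/orP; left.
(* The real part of the power is 1 - 2 (sin a)^2 with 0 < a < pi, hence less than 1. *)
pose a : R := pi * i.+1%:R / m%:R.
have -> : 2 * pi / m%:R *+ i.+1 = a *+ 2 :> R.
  by rewrite -[_ *+ i.+1]mulr_natr -[a *+ 2]mulr_natr /a; field.
rewrite cos_mulr2n cos2sin2.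
have sa : 0 < sin a.
  apply: sin_gt0_pi; apply/andP; split.
    by rewrite !mulr_gt0 ?pi_gt0 ?invr_gt0 ?ltr0n.
  rewrite ltr_pdivrMr ?ltr0n // ltr_pM2l ?pi_gt0 // ltr_nat.
  by rewrite ltn_neqAle im ltn_ord.
have : 0 < sin a ^+ 2 by rewrite exprn_gt0.
by move: (sin a ^+ 2) => s s0; rewrite lt_eqF //; lra.
Qed.

Lemma zeta_quot d q : (0 < d)%N -> (0 < q)%N -> zeta R d = zeta R (d * q) ^+ q.
Proof.
move=> d0 q0; rewrite zetaX /zeta.
suff -> : 2 * pi / (d * q)%:R *+ q = 2 * pi / d%:R :> R by [].
by rewrite -[_ *+ q]mulr_natr natrM; field; rewrite !pnatr_eq0 -!lt0n d0.
Qed.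

End Zeta.

(** * Convex hulls and crossings *)

Section Hulls.
Variables (R : realType) (n : nat).
Hypothesis n_gt0 : (0 < n)%N.
Implicit Types (A B : {set 'I_n}) (x y : 'I_n).

(** Half the angle of the vertex k: with half-angles the equation of a chord becomes a product of
    two sines. *)
Let h (k : R) : R := pi * k / n%:R.

Let n0 : (n%:R : R) != 0. Proof. by rewrite pnatr_eq0 -lt0n. Qed.

Lemma vertexE x : vertex R x =
  Complex (cos (h x%:R) ^+ 2 - sin (h x%:R) ^+ 2)
          (2 * sin (h x%:R) * cos (h x%:R)).
Proof.
rewrite /vertex zetaX.
have -> : 2 * pi / n%:R *+ x = h x%:R *+ 2 :> R.
  by rewrite -[_ *+ x]mulr_natr -[h _ *+ 2]mulr_natr /h; field.
by apply/eqP; rewrite eq_complex /= mulr2n cosD sinD; apply/andP; split; apply/eqP; ring.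
Qed.

Lemma Re_sum (I : finType) (S : {set I}) (f : I -> R[i]) :
  complex.Re (\sum_(i in S) f i) = \sum_(i in S) complex.Re (f i).
Proof.
by apply: (big_ind2 (fun u v => complex.Re u = v)) => // -[a b] _ [c e] _ <- <-.
Qed.

Lemma Im_sum (I : finType) (S : {set I}) (f : I -> R[i]) :
  complex.Im (\sum_(i in S) f i) = \sum_(i in S) complex.Im (f i).
Proof.
by apply: (big_ind2 (fun u v => complex.Im u = v)) => // -[a b] _ [c e] _ <- <-.
Qed.

Let affine (a b : R) (z : R[i]) : R :=
  ((cos a * cos b - sin a * sin b) * complex.Re z
   + (cos a * sin b + sin a * cos b) * complex.Im z
   - (cos a * cos b + sin a * sin b)) / 2.

(* sin (h - a) sin (b - h) is an affine function of the point of the circle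
   with angle 2 h: it vanishes on the chord through the points of angles
   2 a and 2 b. *)
Lemma affine_sum A (l : 'I_n -> R) (a b : R) :
  \sum_(x in A) l x = 1 ->
  affine a b (\sum_(x in A) (l x)%:C * vertex R x) =
    \sum_(x in A) l x * (sin (h x%:R - a) * sin (b - h x%:R)).
Proof.
move=> l1; rewrite /affine Re_sum Im_sum.
set K := cos a * cos b + sin a * sin b.
have -> : K = \sum_(x in A) K * l x by rewrite -mulr_sumr l1 mulr1.
rewrite !mulr_sumr -big_split -sumrB mulr_suml; apply: eq_bigr => x _.
rewrite vertexE /= !sinB.
have := cos2Dsin2 (h x%:R); move: (cos (h x%:R)) (sin (h x%:R)) => c s cs.
have -> : K * l x = K * l x * (c ^+ 2 + s ^+ 2) by rewrite cs mulr1.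
by rewrite /K; field.
Qed.

Lemma h_sub (k l : nat) : (l <= k)%N -> h k%:R - h l%:R = h (k - l)%:R.
Proof. by move=> lk; rewrite /h natrB // mulrBr mulrBl. Qed.

Lemma sin_h_ge0 (k l : nat) : (l <= k <= l + n)%N -> 0 <= sin (h k%:R - h l%:R).
Proof.
case/andP=> lk kln; rewrite h_sub //; apply: sin_ge0_pi; apply/andP; split.
  by rewrite !mulr_ge0 ?pi_ge0 ?invr_ge0 ?ler0n.
by rewrite ler_pdivrMr ?ltr0n // ler_pM2l ?pi_gt0 // ler_nat leq_subLR.
Qed.

Lemma sin_h_gt0 (k l : nat) : (l < k < l + n)%N -> 0 < sin (h k%:R - h l%:R).
Proof.
case/andP=> lk kln; rewrite h_sub ?(ltnW lk) //.
apply: sin_gt0_pi; apply/andP; split.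
  by rewrite !mulr_gt0 ?pi_gt0 ?invr_gt0 ?ltr0n // subn_gt0.
by rewrite ltr_pdivrMr ?ltr0n // ltr_pM2l ?pi_gt0 // ltr_nat ltn_subLR // ltnW.
Qed.

Lemma sin_h_le0 (k l : nat) : (k <= l <= k + n)%N -> sin (h k%:R - h l%:R) <= 0.
Proof. by move/sin_h_ge0 => s0; rewrite -opprB sinN oppr_le0. Qed.

(** The chord function [g] is affine in the vertex, positive on B and nonpositive on A; at a common
    point of the hulls its value would be both. *)
Lemma hull_separated A B (a b : nat) : (a <= b <= a + n)%N ->
  (forall x, x \in B -> (a < x < b)%N) ->
  (forall x, x \in A -> (x <= a /\ b <= n + x)%N \/ (b <= x <= n + a)%N) ->
  forall z, hull R A z -> hull R B z -> False.
Proof.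
move=> /andP[ab ban] Bab Aab z [l [l0 l1 zA]] [m [m0 m1 zB]].
pose g x := sin (h x%:R - h a%:R) * sin (h b%:R - h x%:R).
have gB x : x \in B -> 0 < g x.
  move=> /Bab /andP[ax xb]; have := ltn_ord x.
  by move=> xn; apply: mulr_gt0; apply: sin_h_gt0; lia.
have gA x : x \in A -> g x <= 0.
  have := ltn_ord x => xn; case/Aab => [[xa bx]|/andP[bx xa]].
    by apply: mulr_le0_ge0; [apply: sin_h_le0|apply: sin_h_ge0]; lia.
  by apply: mulr_ge0_le0; [apply: sin_h_ge0|apply: sin_h_le0]; lia.
have sA : \sum_(x in A) l x * g x <= 0.
  by apply: sumr_le0 => x /gA gx; rewrite mulr_ge0_le0.
have sB : 0 < \sum_(x in B) m x * g x.
  have [x xB mx] : exists2 x, x \in B & 0 < m x.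
    apply/exists_inP; apply: contraPT m1 => /exists_inPn mB.
    rewrite big1 => [/eqP|x /mB]; first by rewrite eq_sym oner_eq0.
    by rewrite -leNgt => mx; apply/eqP; rewrite eq_le mx m0.
  rewrite (bigD1 x) //= ltr_pwDl ?(mulr_gt0 mx (gB _ _)) //.
  by apply: sumr_ge0 => y /andP[yB _]; rewrite mulr_ge0 ?(ltW (gB _ _)).
have := affine_sum (h a%:R) (h b%:R) l1; rewrite -zA.
have := affine_sum (h a%:R) (h b%:R) m1; rewrite -zB => -> e.
by move: sA sB; rewrite /g -e => /le_lt_trans /[apply]; rewrite ltxx.
Qed.

Lemma hull_crossing A B (x y z t : 'I_n) : (x < y)%N -> (y < z)%N -> (z < t)%N ->
  x \in A -> z \in A -> y \in B -> t \in B -> exists p, hull R A p /\ hull R B p.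
Proof.
move=> xy yz zt xA zA yB tB.
have hull2 (C : {set 'I_n}) (u v : 'I_n) (a b : R) : u != v -> u \in C -> v \in C ->
    0 < a -> 0 < b ->
    hull R C ((a / (a + b))%:C * vertex R u + (b / (a + b))%:C * vertex R v).
  move=> uv uC vC a0 b0; have ab0 : 0 < a + b by rewrite addr_gt0.
  exists (fun p => if p == u then a / (a + b) else if p == v then b / (a + b) else 0).
  have sum2 (S : zmodType) (f : 'I_n -> S) :
      (forall p, p != u -> p != v -> f p = 0) -> \sum_(p in C) f p = f u + f v.
    move=> f0; rewrite (bigD1 u) //= (bigD1 v) /=; last by rewrite vC eq_sym.
    rewrite big1 => [|p /andP[/andP[_ pu] pv]]; first by rewrite addr0.
    exact: f0.
  split.
  - by move=> p; do 2?[case: eqP => _] => //; rewrite divr_ge0 // ltW.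
  - rewrite sum2 => [|p /negPf -> /negPf -> //].
    by rewrite eqxx eq_sym (negPf uv) eqxx -mulrDl divff ?gt_eqF.
  - rewrite sum2 => [|p /negPf -> /negPf ->]; last by rewrite mul0r.
    by rewrite eqxx [v == u]eq_sym (negPf uv) eqxx.
pose s (u v : 'I_n) := sin (h v%:R - h u%:R).
have s_gt0 (u v : 'I_n) : (u < v)%N -> 0 < s u v.
  by move=> uv; apply: sin_h_gt0; rewrite uv ltn_addl.
have xz := ltn_trans xy yz; have yt := ltn_trans yz zt; have xt := ltn_trans xz zt.
(* Coefficients of the linear relation between the four points: any binary
   quadratic form, such as c^2 + s^2, c^2 - s^2 and 2 c s, satisfies it. *)
pose ax := s y z * s z t * s y t; pose ay := s x z * s z t * s x t.
pose az := s x y * s y t * s x t; pose at_ := s x y * s y z * s x z.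
have [ax0 ay0 az0 at0] : [/\ 0 < ax, 0 < ay, 0 < az & 0 < at_].
  by split; rewrite !mulr_gt0 ?s_gt0.
(* The case c^2 + s^2 = 1 of the relation: the weights on the two chords have the same total. *)
have sumE : ax + az = ay + at_.
  have one (u a : R) : u = u * (cos a ^+ 2 + sin a ^+ 2) by rewrite cos2Dsin2 mulr1.
  rewrite (one ax (h x%:R)) (one az (h z%:R)) (one ay (h y%:R)) (one at_ (h t%:R)).
  by rewrite /ax /ay /az /at_ /s !sinB; ring.
exists ((ax / (ax + az))%:C * vertex R x + (az / (ax + az))%:C * vertex R z).
split; first by apply: hull2; rewrite // neq_ltn xz.
suff -> : (ax / (ax + az))%:C * vertex R x + (az / (ax + az))%:C * vertex R z =
    (ay / (ay + at_))%:C * vertex R y + (at_ / (ay + at_))%:C * vertex R t.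
  by apply: hull2; rewrite // neq_ltn yt.
have D0 : ay + at_ != 0 by rewrite gt_eqF ?addr_gt0.
rewrite sumE !vertexE; apply/eqP; rewrite eq_complex /=.
apply/andP; split; apply/eqP; rewrite !mul0r ?subr0 ?addr0.
  rewrite ![_ / (ay + at_) * _]mulrAC -!mulrDl; congr (_ / _).
  by rewrite /ax /ay /az /at_ /s !sinB; ring.
rewrite ![_ / (ay + at_) * _]mulrAC -!mulrDl; congr (_ / _).
by rewrite /ax /ay /az /at_ /s !sinB; ring.
Qed.

End Hulls.

(** * Noncrossing partitions, stable blocks and rotations *)

Section Noncrossing.
Variables (R : realType) (n : nat).
Hypothesis n_gt0 : (0 < n)%N.
Implicit Types (P : {set {set 'I_n}}) (A B : {set 'I_n}) (x y : 'I_n).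

Local Notation blk := finset.pblock.

Lemma NCP11P P : NCP11 R n P <->
  finset.partition P [set: 'I_n] /\ noncrossing (fun x y => y \in blk P x).
Proof.
split=> [[partP disj]|[partP nc]].
  have /and3P[/eqP cP tP _] := partP.
  have Pblk x : blk P x \in P by rewrite pblock_mem // cP inE.
  have mem x : x \in blk P x by rewrite mem_pblock cP inE.
  split=> // x y z t xy yz zt xz yt; apply/negPn/negP => nxy.
  have nAB : blk P x != blk P y by apply: contraNneq nxy => ->.
  have [p pAB] := hull_crossing R n_gt0 xy yz zt (mem x) xz (mem y) yt.
  have := disj _ _ (Pblk x) (Pblk y) nAB.
  by move/seteqP => [/(_ p)+ _]; apply.
split=> // A B AP BP AB; rewrite -subset0 => p [pA pB] /=.
have /and3P[_ _ P0] := partP.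
have An0 : A != finset.set0 by apply: contraNneq P0 => <-.
have Bn0 : B != finset.set0 by apply: contraNneq P0 => <-.
have [a0 a0A a0m] := min_block An0; have [b0 b0B b0m] := min_block Bn0.
have /and3P[_ tP _] := partP.
have : a0 != b0.
  apply: contraNneq AB => ab; rewrite -(def_pblock tP AP a0A) ab.
  by rewrite (def_pblock tP BP b0B).
rewrite -val_eqE neq_ltn => /orP[lt|lt].
  have [a [b [ab sB sA]]] := noncrossing_separated partP nc AP BP AB a0A a0m b0B b0m lt.
  exact: (hull_separated n_gt0 ab sB sA pA pB).
rewrite eq_sym in AB.
have [a [b [ab sB sA]]] := noncrossing_separated partP nc BP AP AB b0B b0m a0A a0m lt.
exact: (hull_separated n_gt0 ab sB sA pB pA).
Qed.

Lemma vertex_shift k x : vertex R (shift k x) = zeta R n ^+ k * vertex R x.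
Proof.
by rewrite /vertex /= (prim_expr_mod (zeta_prim R n_gt0)) exprD mulrC.
Qed.

Variables d q : nat.
Hypotheses (q_gt0 : (0 < q)%N) (hn : n = (d * q)%N).

(* 0 is the barycentre of the vertices in A. *)
Lemma stable_hull0 A : A != finset.set0 -> stable d q A -> hull R A 0.
Proof.
move=> A0 /existsP[a /andP[a_gt0 /eqP aA]].
have S0 : \sum_(x in A) vertex R x = 0.
  have : \sum_(x in A) vertex R x = zeta R n ^+ (a * q) * \sum_(x in A) vertex R x.
    rewrite -{1}aA big_imset /=; last by move=> x y _ _; exact: shift_inj.
    by rewrite mulr_sumr; apply: eq_bigr => x _; exact: vertex_shift.
  move/eqP; rewrite -subr_eq0 -{1}[\sum_(_ in _) _]mul1r -mulrBl mulf_eq0 => /orP[|/eqP//].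
  rewrite subr_eq0 eq_sym -(prim_order_dvd (zeta_prim R n_gt0)) gtnNdvd //.
    by rewrite muln_gt0 a_gt0.
  by rewrite hn ltn_pmul2r.
have cA : (#|A|%:R : R) != 0 by rewrite pnatr_eq0 cards_eq0.
exists (fun=> #|A|%:R^-1); split.
- by move=> x; rewrite invr_ge0 ler0n.
- by rewrite sumr_const -[_ *+ _]mulr_natr mulVf.
- by rewrite -mulr_sumr S0 mulr0.
Qed.

Lemma num_stable_le1 (s : 'S_n) : NCP11 R n (porbits s) -> (num_stable d q s <= 1)%N.
Proof.
move=> [/and3P[_ _ P0] disj]; apply/card_le1_eqP => A B.
rewrite !inE => /andP[AP stA] /andP[BP stB]; apply/eqP/negPn/negP => AB.
have hull0 C : C \in porbits s -> stable d q C -> hull R C 0.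
  by move=> CP; apply: stable_hull0; apply: contraNneq P0 => <-.
have := disj _ _ BP AP AB => /seteqP[/(_ 0)+ _]; apply.
by split; apply: hull0.
Qed.

Lemma rotate_turn a A : (0 < d)%N -> rotate (zeta R d ^+ a) A = turn q a A.
Proof.
move=> d0; have vE x y : (vertex R y == zeta R d ^+ a * vertex R x) = (y == shift (a * q) x).
  rewrite (zeta_quot R d0 q_gt0) -hn -exprM mulnC -vertex_shift /vertex.
  rewrite (eq_prim_root_expr (zeta_prim R n_gt0)) !modn_small // ?ltn_ord //.
apply/setP => y; rewrite inE.
apply/exists_inP/imsetP => [[x xA]|[x xA ->]].
  by rewrite vE => /eqP ->; exists x.
by exists x; rewrite ?vE.
Qed.

End Noncrossing.

(** * The group G(d,1,q) *)

Section Bridge.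
Variables (R : realType) (d q : nat).
Hypotheses (d_gt0 : (0 < d)%N) (q_gt0 : (0 < q)%N).
Implicit Types (s t : 'S_(d * q)) (p : 'I_(d * q)) (w : 'M[R[i]]_q).

Local Notation n := (d * q)%N.
Local Notation cen := 'C[rot n q]%g.
Let hn : n = (d * q)%N := erefl.
Let z_prim := zeta_prim R d_gt0.
Local Notation point := (@Defs.point d q).
Local Notation vec := (vec (zeta R d) q_gt0).
Local Notation Mx := (Mx q_gt0 hn z_prim).
Local Notation low := (low hn z_prim).
Local Notation refl_len := (refl_len q_gt0 hn z_prim).
Local Notation below := (below q_gt0 hn z_prim).

(* Mx acts on row vectors, the matrices of G(d,1,q) on column vectors. *)
Definition mono s : 'M[R[i]]_q := (Mx s)^T.

Lemma dq_gt0 : (0 < n)%N. Proof. by rewrite muln_gt0 d_gt0. Qed.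

Lemma point_shift (j : 'I_d) (i : 'I_q) : point j i = shift (j * q) (low i).
Proof.
by apply: val_inj; rewrite /= [(i + _)%N]addnC modn_small // point_subproof.
Qed.

Lemma pointP p : exists j i, p = point j i.
Proof.
have lt_pd : (p %/ q < d)%N by rewrite ltn_divLR.
exists (Ordinal lt_pd), (Ordinal (ltn_pmod p q_gt0)).
by apply: val_inj; rewrite /= -divn_eq.
Qed.

Lemma point_addZ (j a : 'I_d) (k : 'I_q) :
  point (addZ j a) k = shift (j * q) (point a k).
Proof.
rewrite !point_shift shiftD -mulnDl [RHS]/(shift _ _) -[RHS]shift_modn.
by rewrite -muln_modl addnC.
Qed.

Lemma vec_point (a : 'I_d) (k : 'I_q) :
  vec (point a k) = zeta R d ^+ a *: delta_mx 0 k.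
Proof. by rewrite point_shift (vec_shift q_gt0 hn z_prim) vec_low. Qed.

Lemma col_mono s i : col i (mono s) = (vec (s (low i)))^T.
Proof. by rewrite -tr_row rowK. Qed.

Lemma monoE s k i : mono s k i =
  zeta R d ^+ (s (low i) %/ q) * (s (low i) %% q == k :> nat)%N%:R.
Proof. by rewrite !mxE eqxx /= eq_sym. Qed.

Lemma zetaX_neq0 k : zeta R d ^+ k != 0.
Proof. by rewrite expf_neq0 // (prim_root_eq0 z_prim) -lt0n. Qed.

Lemma mono_neq0 s k i : (mono s k i != 0) = (s (low i) %% q == k :> nat)%N.
Proof.
by rewrite monoE mulf_eq0 (negPf (zetaX_neq0 _)) pnatr_eq0 eqb0 negbK.
Qed.

Lemma mono_Gd1q s : s \in cen -> Gd1q R d q (mono s).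
Proof.
move=> sC; split.
- move=> i; exists (Ordinal (ltn_pmod (s (low i)) q_gt0)).
  split=> [|k]; first by rewrite mono_neq0.
  by rewrite mono_neq0 => /eqP e; apply: val_inj.
- move=> k; set p := (s^-1)%g (low k); exists (Ordinal (ltn_pmod p q_gt0)).
  have sE i : (s (low i) %% q == k :> nat)%N = (i == p %% q :> nat)%N.
    have := cen_modq q_gt0 hn z_prim (low i) p sC.
    by rewrite permKV /= !(modn_small (ltn_ord _)).
  split=> [|i]; first by rewrite mono_neq0 sE.
  by rewrite mono_neq0 sE => /eqP e; apply: val_inj.
- move=> k i; rewrite mono_neq0 monoE => ->; rewrite mulr1 unity_rootE.
  by rewrite exprAC (prim_expr_order z_prim) expr1n.
Qed.

(** Each column of w is the vector of a point [f i]; the map f is extended to all points so as to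
    commute with the rotation by q. The extension is injective because a row of w has only one
    nonzero entry. *)
Lemma Gd1q_mono w : Gd1q R d q w -> exists2 s, s \in cen & w = mono s.
Proof.
move=> [colw roww unitw].
have [f fE] : exists f : 'I_q -> 'I_n, forall i, col i w = (vec (f i))^T.
  apply: (@fin_all_exists _ (fun=> 'I_n) (fun i p => col i w = (vec p)^T)) => i.
  have [k [wki kU]] := colw i; have := unitw _ _ wki.
  rewrite unity_rootE => /eqP /(prim_rootP z_prim) [a wE].
  exists (point a k); rewrite vec_point; apply/colP => l; rewrite !mxE eqxx /=.
  have [->|lk] := eqVneq l k; first by rewrite mulr1.
  rewrite mulr0; apply/eqP/negPn/negP => /kU kl.
  by rewrite kl eqxx in lk.
have wE k i : w k i = vec (f i) 0 k.
  by have /colP/(_ k) := fE i; rewrite !mxE.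
have w_neq0 i : w (Ordinal (ltn_pmod (f i) q_gt0)) i != 0.
  by rewrite wE !mxE !eqxx mulr1 zetaX_neq0.
pose res (p : 'I_n) := Ordinal (ltn_pmod p q_gt0).
pose g p : 'I_n := shift (p %/ q * q) (f (res p)).
have g_inj : injective g.
  move=> p p' e; have fm : f (res p) = f (res p') %[mod q].
    by have := congr1 (fun x : 'I_n => (x %% q)%N) e; rewrite !(shift_modq hn).
  have rE : res p = res p'.
    have [i [_ iU]] := roww (Ordinal (ltn_pmod (f (res p)) q_gt0)).
    transitivity i; first by apply/esym/iU/w_neq0.
    apply: iU; have -> : Ordinal (ltn_pmod (f (res p)) q_gt0) =
      Ordinal (ltn_pmod (f (res p')) q_gt0) by apply: val_inj.
    exact: w_neq0.
  move: e; rewrite /g rE => /(shiftq_inj q_gt0 hn).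
  rewrite !ltn_divLR // => /(_ (ltn_ord _) (ltn_ord _)) e.
  apply: val_inj; rewrite /= (divn_eq p q) (divn_eq p' q) e; congr (_ + _)%N.
  exact: (congr1 val rE).
have sC : perm g_inj \in cen.
  apply: cenP => p; rewrite !permE /g.
  have -> : res (shift q p) = res p.
    by apply: val_inj; rewrite /= (modn_modq hn) modnDr.
  rewrite shiftD -[LHS]shift_modn -[RHS]shift_modn; congr shift.
  by rewrite /= -modn_divl divnDr // divnn q_gt0 muln_modl modn_mod mulnDl mul1n.
exists (perm g_inj) => //; apply/matrixP => k i.
have /colP/(_ k) := col_mono (perm g_inj) i; rewrite [LHS]mxE => ->.
rewrite wE [RHS]mxE permE /g; congr (vec _ 0 k).
rewrite divn_small ?(ltn_ord i) // mul0n shift0; congr (val (f _)).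
by apply: val_inj; rewrite /= modn_small.
Qed.

Lemma acts_as_mono s t : s \in cen -> acts_as (mono s) t = (t == s).
Proof.
move=> sC; have colE i (a : 'I_d) (k : 'I_q) :
    (col i (mono s) == zeta R d ^+ a *: delta_mx k 0) = (s (low i) == point a k).
  have -> : zeta R d ^+ a *: delta_mx k 0 = (vec (point a k))^T.
    by rewrite vec_point linearZ /= trmx_delta.
  rewrite col_mono (inj_eq trmx_inj); apply/eqP/eqP => [|-> //].
  exact: (vec_inj hn z_prim).
apply/idP/eqP => [/forallP actP|->].
  apply/permP => p; have [j [i ->]] := pointP p.
  have [a [k skE]] := pointP (s (low i)).
  have /forallP/(_ k)/forallP/(_ a)/implyP := actP i.
  rewrite colE skE eqxx => /(_ isT)/forallP/(_ j)/eqP ->.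
  by rewrite point_addZ (point_shift j i) cen_shift // skE.
apply/forallP => i; apply/forallP => k; apply/forallP => a; apply/implyP.
rewrite colE => /eqP skE; apply/forallP => j.
by rewrite point_addZ (point_shift j i) cen_shift // skE.
Qed.

Lemma perm_image_mono s : s \in cen -> perm_image d (mono s) = s.
Proof.
move=> sC; rewrite /perm_image; case: pickP => [t|/(_ s)].
  by rewrite acts_as_mono // => /eqP.
by rewrite acts_as_mono // eqxx.
Qed.

Lemma mx_orbits_mono s : s \in cen -> mx_orbits d (mono s) = porbits s.
Proof. by move=> sC; rewrite /mx_orbits perm_image_mono. Qed.

Lemma monoM s t : s \in cen -> t \in cen -> mono (s * t)%g = mono t *m mono s.
Proof. by move=> sC tC; rewrite /mono MxM // trmx_mul. Qed.

Lemma codim_fix_tr w : codim_fix w^T = codim_fix w.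
Proof. by rewrite /codim_fix -mxrank_tr linearB /= trmx1 trmxK. Qed.

Lemma codim_fix_mono s : codim_fix (mono s) = refl_len s.
Proof. exact: codim_fix_tr. Qed.

Lemma reflectionsP w : reflections R d q w <-> Gd1q R d q w /\ codim_fix w = 1%N.
Proof.
rewrite /reflections /= /eigenspace mxrank_ker -/(codim_fix _) codim_fix_tr.
by have := codim_fix_le w; split=> -[Gw e]; split=> //; lia.
Qed.

(** Transposition reverses products, hence the reversed word. *)
Lemma mono_word (rs : seq 'S_n) : (forall r, r \in rs -> r \in cen) ->
  \big[mulmx/1%:M]_(w <- rev (map mono rs)) w = mono (\prod_(r <- rs) r)%g.
Proof.
elim: rs => [|r rs IHrs] rsC.
  by rewrite !big_nil /mono Mx1 trmx1.
have rC : r \in cen by rewrite rsC ?mem_head.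
have {}rsC x : x \in rs -> x \in cen by move=> xrs; rewrite rsC // inE xrs orbT.
have prodC : (\prod_(r <- rs) r)%g \in cen.
  by rewrite big_seq; apply: group_prod.
rewrite /= rev_cons big_cons monoM // -IHrs //; elim: (rev _) => [|w ws IHws] /=.
  by rewrite big_cons !big_nil mulmx1 mul1mx.
by rewrite !big_cons IHws mulmxA.
Qed.

(** No word is shorter, since each reflection has [codim_fix] equal to 1 and this codimension is
    subadditive; [refl_word] attains the bound. *)
Lemma refl_length_mono s : s \in cen -> refl_length d (mono s) = refl_len s.
Proof.
move=> sC; have lower k : is_word_length d (mono s) k -> (refl_len s <= k)%N.
  case=> rs [<- rsP]; rewrite -codim_fix_mono => <-.
  elim: rs rsP => [|r rs IHrs] rsP.
    by rewrite big_nil /codim_fix subrr mxrank0.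
  rewrite big_cons (leq_trans (codim_fixM _ _)) //= -add1n leq_add //.
    by have /reflectionsP[_ ->] := rsP _ (mem_head _ _).
  by apply: IHrs => x xrs; apply: rsP; rewrite inE xrs orbT.
have word : is_word_length d (mono s) (refl_len s).
  have [rs [sz rsP rsE]] := refl_word q_gt0 hn z_prim sC.
  exists (rev (map mono rs)); split; first by rewrite size_rev size_map.
    move=> w; rewrite mem_rev => /mapP[r /rsP[rC r1] ->]; apply/reflectionsP.
    by rewrite codim_fix_mono; split=> //; exact: mono_Gd1q.
  by rewrite mono_word ?rsE // => r /rsP[].
apply: xget_unique; first by split.
by move=> k [kw kmin]; apply/eqP; rewrite eqn_leq lower // kmin.
Qed.

Lemma invmx_mono s : s \in cen -> invmx (mono s) = mono s^-1%g.
Proof. by move=> sC; rewrite /mono -trmx_inv MxV. Qed.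

Lemma absle_mono s t : s \in cen -> t \in cen ->
  absle d (mono s) (mono t) <-> below s t.
Proof.
move=> sC tC; rewrite /absle /below invmx_mono // -monoM ?groupV //.
have uC : (t * s^-1)%g \in cen by rewrite groupM ?groupV.
(* As [mono] reverses products, the quotient is t s^-1, a conjugate of s^-1 t. *)
rewrite -(refl_lenV_quot _ _ _ sC tC).
move: (t * s^-1)%g uC => u uC.
have aux (a b e a' b' e' : nat) : a = a' -> b = b' -> e = e' ->
  (a + b = e <-> a' + b' = e')%N by move=> -> -> ->.
exact: aux (refl_length_mono sC) (refl_length_mono uC) (refl_length_mono tC).
Qed.

Lemma coxeter_mono : coxeter R d q = mono (rot n 1).
Proof.
apply/matrixP => k i; have /colP/(_ k) := col_mono (rot n 1) i.
rewrite [LHS]mxE => ->; rewrite [LHS]mxE [RHS]mxE rotE.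
rewrite (vec_mod q_gt0 hn z_prim) /= addn1.
rewrite !mxE eqxx /=; have := ltn_ord i; rewrite leq_eqVlt => /orP[/eqP iq|iq].
  (* In the last column the image is the point number q, that is e(1,0), with exponent q / q = 1. *)
  rewrite iq eqxx divnn q_gt0 expr1 -val_eqE /= modnn.
  rewrite (ltn_eqF (ltn_ord k)) eq_sym /=.
  by case: eqP; rewrite ?mulr1 ?mulr0.
rewrite divn_small // expr0 mul1r (ltn_eqF iq) /= -val_eqE /= modn_small //.
by case: eqP.
Qed.

Local Notation c := (rot n 1).

Lemma rot1_cen : c \in cen. Proof. exact: rot_cen. Qed.

Lemma interval_mono s : s \in cen -> interval_c R d q (mono s) <-> below s c.
Proof.
move=> sC; rewrite /interval_c /= coxeter_mono; split=> [[_]|sc].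
  by move/(absle_mono sC rot1_cen).
by split; [exact: mono_Gd1q|exact/(absle_mono sC rot1_cen)].
Qed.

Lemma intervalP w : interval_c R d q w ->
  exists s, [/\ s \in cen, w = mono s, below s c & mx_orbits d w = porbits s].
Proof.
move=> wI; have [s sC wE] := Gd1q_mono wI.1.
exists s; split; [exact: sC|exact: wE| |].
  by apply/(interval_mono sC); rewrite -wE; exact: wI.
by rewrite wE; exact: mx_orbits_mono.
Qed.

Lemma below_c_abs s : s \in cen -> below s c -> abs_below s c.
Proof.
move=> sC; apply: (below_abs_below sC rot1_cen).
exact: (num_stable_rot1_le q_gt0 hn z_prim).
Qed.

Lemma abs_below_NCP11 s : abs_below s c -> NCP11 R n (porbits s).
Proof.
move=> sc; apply/(NCP11P _ dq_gt0); split; first exact: partition_porbits.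
move=> x y z t xy yz zt; rewrite !pblock_porbits.
exact: (abs_below_noncrossing dq_gt0 sc xy yz zt).
Qed.

Lemma abs_below_num_stable s : abs_below s c -> (num_stable d q s <= 1)%N.
Proof. by move=> /abs_below_NCP11; apply: num_stable_le1 => //; exact: dq_gt0. Qed.

Lemma NCPd1P (P : {set {set 'I_n}}) : NCPd1 R d q P <->
  NCP11 R n P /\ forall a, [set turn q a A | A in P]%SET = P.
Proof.
split=> -[PN inv]; split=> //.
  move=> a; rewrite -[RHS](inv (zeta R d ^+ a)).
    by apply: eq_imset => A; rewrite (rotate_turn R dq_gt0 q_gt0 hn).
  by rewrite unity_rootE exprAC (prim_expr_order z_prim) expr1n.
move=> z; rewrite unity_rootE => /eqP/(prim_rootP z_prim)[a ->].
by rewrite -[RHS](inv a); apply: eq_imset => A; rewrite (rotate_turn R dq_gt0 q_gt0 hn).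
Qed.

Lemma porbits_NCPd1 s : s \in cen -> abs_below s c -> NCPd1 R d q (porbits s).
Proof.
move=> sC sc; apply/NCPd1P; split; first exact: abs_below_NCP11.
move=> a; apply/setP => A; apply/imsetP/imsetP => [[_ /imsetP[p _ ->] ->]|[p _ ->]].
  by exists (shift (a * q) p); rewrite // turn_porbit.
exists (porbit s ((rot n (a * q))^-1%g p)); first exact: imset_f.
by rewrite turn_porbit // -rotE permKV.
Qed.

Lemma refines_porbits s t :
  refines (porbits s) (porbits t) <-> refines_orbits s t.
Proof.
split=> [st p|st _ /imsetP[p _ ->]].
  have [|_ /imsetP[p' _ ->] /fintype.subsetP sub] := st (porbit s p).
    exact: imset_f.
  have /eq_porbit pp' := sub p (porbit_id s p).
  by rewrite pp' sub // (mem_porbit s 1).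
exists (porbit t p); first exact: imset_f.
apply/fintype.subsetP => y /porbitP[k ->]; elim: k => [|k IHk].
  by rewrite expg0 perm1 porbit_id.
by rewrite expgSr permM -(eq_porbit IHk) st.
Qed.

(** Since t has at most one stable orbit, the order passes to the symmetric group, where it implies
    refinement; the converse is [refines_below]. *)
Lemma below_refines s t : s \in cen -> t \in cen ->
  below s c -> below t c -> below s t <-> refines (porbits s) (porbits t).
Proof.
move=> sC tC sc tc; rewrite refines_porbits; split; last first.
  exact: (refines_below sC tC rot1_cen sc tc).
move=> /(below_abs_below sC tC) st; apply/(abs_below_refines dq_gt0)/st.
exact/abs_below_num_stable/below_c_abs.
Qed.

(** Invariance of P makes [next] commute with the rotation by q. Its order relation is carried back
    from the symmetric group by counting stable orbits; the complement of [next] has at most one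
    because it is also below the n-cycle. *)
Lemma NCPd1_below (P : {set {set 'I_n}}) : NCPd1 R d q P ->
  exists s, [/\ s \in cen, below s c & porbits s = P].
Proof.
case/NCPd1P=> /[dup] PN /(NCP11P _ dq_gt0)[partP nc] inv.
have /and3P[/eqP cP tP _] := partP.
have sC : next dq_gt0 partP \in cen.
  apply: cenP; apply: next_shift => x y.
  have turnP : turn q 1 (finset.pblock P x) \in P.
    have xP : finset.pblock P x \in P by rewrite pblock_mem // cP finset.in_setT.
    by have := imset_f (turn q 1) xP; rewrite (inv 1%N).
  have mem_x : shift q x \in turn q 1 (finset.pblock P x).
    by rewrite -[q in shift q]mul1n mem_turn // mem_pblock cP finset.in_setT.
  rewrite (def_pblock tP turnP mem_x) -[q in shift q]mul1n.
  by rewrite /turn mem_imset //; exact: shift_inj.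
have sc := next_abs_below dq_gt0 partP nc.
exists (next dq_gt0 partP); split; [exact: sC| |exact: porbits_next].
apply: (abs_below_below q_gt0 hn z_prim sC rot1_cen _ _ sc).
  have [d1|d1] := ltnP 1 d.
    by rewrite (num_stable_rot1 q_gt0 hn z_prim d1) abs_below_num_stable.
  have d1' : d = 1%N by apply/eqP; rewrite eqn_leq d1.
  by rewrite num_stable_d1.
exact/abs_below_num_stable/(abs_below_compl dq_gt0 sc).
Qed.

End Bridge.

Theorem corollary3p14 (R : realType) (d q : nat) (hd : (0 < d)%N)
    (hq : (0 < q)%N) :
  set_bij (interval_c R d q) (NCPd1 R d q) (mx_orbits d) /\
  (forall v w : 'M[complex R]_q, interval_c R d q v -> interval_c R d q w ->
     (absle d v w <->
      refines (mx_orbits d v) (mx_orbits d w))).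
Proof.
split; last first.
  move=> v w /(intervalP hd hq)[s [sC vE sc vs]] /(intervalP hd hq)[t [tC wE tc wt]].
  rewrite {}vs {}wt {}vE {}wE.
  exact: iff_trans (absle_mono R hd hq sC tC) (below_refines sC tC sc tc).
split.
- move=> w /(intervalP hd hq)[s [sC _ sc ws]].
  by have := porbits_NCPd1 R hd hq sC (below_c_abs sC sc); rewrite -ws.
- move=> v w /set_mem/(intervalP hd hq)[s [sC vE sc vs]].
  move=> /set_mem/(intervalP hd hq)[t [tC wE tc wt]]; rewrite {}vs {}wt {}vE {}wE => st.
  (* Equal orbit partitions refine each other, so injectivity follows from antisymmetry. *)
  have refl n (P : {set {set 'I_n}}) : refines P P by move=> A; exists A.
  have [_ le_st] := below_refines sC tC sc tc.
  have [_ le_ts] := below_refines tC sC tc sc.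
  rewrite st in le_st le_ts; congr mono.
  exact: below_antisym sC tC (le_st (refl _ _)) (le_ts (refl _ _)).
- move=> P /(NCPd1_below hd hq)[s [sC sc <-]]; exists (mono R hd hq s).
    exact: (interval_mono R hd hq sC).2 sc.
  exact: mx_orbits_mono.
Qed.
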